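(* Let $\Omega$ be a ccdg-Hopf algebra and let $\omega:\underline{\mathbf{dgMod}}_L(\Omega)\to\underline{\mathbf{Ch}}(\Bbbk)$ be the forgetful dg-functor. There are natural isomorphisms of presheaves $$\mathcal{E}_\omega\cong\mathcal{E}_\Omega:\mathbf{ccdgC}(\Bbbk)^{op}\to\mathbf{dgA}(\Bbbk),\qquad \mathcal{P}^\otimes_\omega\cong\mathcal{P}_\Omega:\mathbf{ccdgC}(\Bbbk)^{op}\to\mathbf{Grp}.$$ In particular the presheaf of groups $\mathcal{P}^\otimes_\omega$ on $\mathbf{ccdgC}(\Bbbk)$ is representable and represented by the ccdg-Hopf algebra $\Omega$.
   Context: $\Bbbk$ is a field of characteristic zero. All graded objects are $\mathbb{Z}$-graded with homological grading, $\otimes=\otimes_\Bbbk$, and the Koszul sign rule is used; $\tau(x\otimes y)=(-1)^{|x||y|}y\otimes x$. For chain complexes $V,W$, $\mathrm{Hom}(V,W)=\bigoplus_n\mathrm{Hom}(V,W)_n$ has differential $\partial_{V,W}f=\partial_W\circ f-(-1)^{|f|}f\circ\partial_V$. $\imath_V:\Bbbk\otimes V\to V$ is the canonical isomorphism and $\mathbb{I}$ denotes identity maps. $\mathbf{dgA}(\Bbbk)$ is the category of unital associative dg-algebras. A ccdg-coalgebra $C=(C,\epsilon_C,\Delta_C,\partial_C)$ is a counital coassociative graded-cocommutative dg-coalgebra; morphisms are degree $0$ chain maps compatible with counits and coproducts; the category is $\mathbf{ccdgC}(\Bbbk)$. A ccdg-Hopf algebra $\Omega=(\Omega,u_\Omega,m_\Omega,\epsilon_\Omega,\Delta_\Omega,\varsigma_\Omega,\partial_\Omega)$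 is simultaneously a unital associative dg-algebra and a ccdg-coalgebra such that $\epsilon_\Omega,\Delta_\Omega$ are dg-algebra morphisms, with an antipode $\varsigma_\Omega$ (degree $0$ linear, $m_\Omega(\varsigma_\Omega\otimes\mathbb{I})\Delta_\Omega=m_\Omega(\mathbb{I}\otimes\varsigma_\Omega)\Delta_\Omega=u_\Omega\epsilon_\Omega$). $\mathcal{E}_\Omega$ sends $C$ to the convolution dg-algebra $(\mathrm{Hom}(C,\Omega),u_\Omega\circ\epsilon_C,\star_{C,\Omega},\partial_{C,\Omega})$, $\alpha_1\star_{C,\Omega}\alpha_2=m_\Omega\circ(\alpha_1\otimes\alpha_2)\circ\Delta_C$, and $f:C\to C'$ to $\alpha'\mapsto\alpha'\circ f$. $\mathcal{P}_\Omega$ sends $C$ to the group $(\mathrm{Hom}_{\mathbf{ccdgC}(\Bbbk)}(C,\Omega),u_\Omega\circ\epsilon_C,\star_{C,\Omega})$ (inverse $g^{-1}=\varsigma_\Omega\circ g$) and $f$ to $g'\mapsto g'\circ f$. Left dg-modules $(M,\gamma_M)$ over $\Omega$ form a dg-category $\underline{\mathbf{dgMod}}_L(\Omega)$: morphisms are linear maps $\psi:M\to M'$ of any degree with $\psi\circ\gamma_M=\gamma_{M'}\circ(\mathbb{I}_\Omega\otimes\psi)$, with differential $\partial_{M,M'}$. Tensor product $(M,\gamma_M)\otimes_{\Delta_\Omega}(M',\gamma_{M'})$: the complex $M\otimes M'$ with action $(\gamma_M\otimes\gamma_{M'})\circ(\mathbb{I}_\Omega\otimes\tau\otimes\mathbb{I}_{M'})\circ(\Delta_\Omega\otimes\mathbb{I}_{M\otimes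 M'})$; unit $\Bbbk$ with action $\epsilon_\Omega$. $\underline{\mathbf{Ch}}(\Bbbk)$ is the dg-category of chain complexes; $\omega(M,\gamma_M)=M$. For a ccdg-coalgebra $C$, an element $\eta^C\in\mathsf{End}(C\otimes\omega)$ of degree $n$ is a family, indexed by left dg-modules $(M,\gamma_M)$, of degree $n$ linear maps $\eta^C_M:C\otimes M\to C\otimes M$ which are morphisms of cofree left $C$-comodules, $(\Delta_C\otimes\mathbb{I}_M)\circ\eta^C_M=(\mathbb{I}_C\otimes\eta^C_M)\circ(\Delta_C\otimes\mathbb{I}_M)$, and natural: $(\mathbb{I}_C\otimes\psi)\circ\eta^C_M=(-1)^{n|\psi|}\eta^C_{M'}\circ(\mathbb{I}_C\otimes\psi)$ for every morphism $\psi:(M,\gamma_M)\to(M',\gamma_{M'})$. With composition, unit $\mathbb{I}_{C\otimes\omega}$ and differential $(\delta^C\eta^C)_M:=\partial_{C\otimes M,C\otimes M}\eta^C_M$ this is a dg-algebra $\mathcal{E}_\omega(C)$. For comodule maps $\varphi:C\otimes M\to C\otimes N$, $\varphi':C\otimes M'\to C\otimes N'$, put $\check{\mathfrak q}(\varphi')=\imath_{N'}\circ(\epsilon_C\otimes\mathbb{I}_{N'})\circ\varphi'$ and $\varphi\otimes_{\Delta_C}\varphi':=(\varphi\otimes\check{\mathfrak q}(\varphi'))\circ(\mathbb{I}_C\otimes\tau\otimes\mathbb{I}_{M'})\circ(\Delta_C\otimes\mathbb{I}_{M\otimes M'})$. A morphism $f:C\to C'$ induces $\mathcal{E}_\omega(f):\mathcal{E}_\omega(C')\to\mathcal{E}_\omega(C)$,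 $\mathcal{E}_\omega(f)(\eta^{C'})_M:=(\mathbb{I}_C\otimes\check{\mathfrak q}(\eta^{C'}_M))\circ(\mathbb{I}_C\otimes f\otimes\mathbb{I}_M)\circ(\Delta_C\otimes\mathbb{I}_M)$. $Z_0\mathsf{End}^\otimes(C\otimes\omega)$ is the set of degree $0$ elements $\eta^C$ with $\delta^C\eta^C=0$, $\eta^C_\Bbbk=\mathbb{I}_{C\otimes\Bbbk}$ and $\eta^C_{M\otimes_{\Delta_\Omega}M'}=\eta^C_M\otimes_{\Delta_C}\eta^C_{M'}$ for all left dg-modules $M,M'$. $\mathcal{P}^\otimes_\omega$ sends $C$ to the group $Z_0\mathsf{End}^\otimes(C\otimes\omega)$ under composition and $f$ to the restriction of $\mathcal{E}_\omega(f)$. *)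

(* Defs.v *)
From HB Require Import structures.
From mathcomp Require Import all_boot all_order all_algebra.
From mathcomp Require Import boolp.

Set Implicit Arguments.
Unset Strict Implicit.
Unset Printing Implicit Defensive.
Import Order.TTheory GRing.Theory.
Local Open Scope ring_scope.

(* A chain complex is a k-module V = \bigoplus_n V_n whose grading is given by
   the projections [pr n] onto the V_n (so V_n = {v | pr n v = v}), with a
   differential of degree -1. *)
HB.mixin Record isComplex (k : fieldType) V of GRing.Lmodule k V := {
  pr : int -> {linear V -> V};
  pr_pr : forall m n v, pr m (pr n v) = if m == n then pr n v else 0;
  pr_sum : forall v, exists2 s : seq int, uniq s & v = \sum_(i <- s) pr i v;
  dif : {linear V -> V};
  dif_pr : forall n v, dif (pr n v) = pr (n - 1) (dif v);
  dif_dif : forall v, dif (dif v) = 0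
}.

#[short(type="complexType")]
HB.structure Definition Complex (k : fieldType) :=
  {V of GRing.Lmodule k V & isComplex k V}.

Section Linear.
Variable k : fieldType.
Implicit Types U V W : lmodType k.

Definition mklin V U (f : V -> U) (fl : linear f) : {linear V -> U} :=
  HB.pack f (GRing.isLinear.Build k V U *:%R f fl).

Lemma mklinE V U (f : V -> U) (fl : linear f) : mklin fl = f :> (V -> U).
Proof. by []. Qed.

Definition idl V : {linear V -> V} := idfun.
Definition lcomp U V W (g : {linear V -> W}) (f : {linear U -> V}) :
  {linear U -> W} := g \o f.
Definition ladd V W (f g : {linear V -> W}) : {linear V -> W} := f \+ g.
Definition lsub V W (f g : {linear V -> W}) : {linear V -> W} := f \- g.
Lemma lscale_linear V W (a : k) (f : {linear V -> W}) :
  linear (fun v => a *: f v).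
Proof. by move=> b u v; rewrite linearP scalerDr !scalerA mulrC. Qed.
Definition lscale V W (a : k) (f : {linear V -> W}) : {linear V -> W} :=
  mklin (lscale_linear a f).
Definition lzero V W : {linear V -> W} := \0.

Lemma lcompE U V W (g : {linear V -> W}) (f : {linear U -> V}) u :
  lcomp g f u = g (f u).
Proof. by []. Qed.

Lemma lsubE V W (f g : {linear V -> W}) v : lsub f g v = f v - g v.
Proof. by []. Qed.

Lemma lscaleE V W a (f : {linear V -> W}) v : lscale a f v = a *: f v.
Proof. by []. Qed.

Lemma linZ V W (f : {linear V -> W}) a v : f (a *: v) = a *: f v.
Proof. exact: linearZ. Qed.

Lemma linD V W (f : {linear V -> W}) u v : f (u + v) = f u + f v.
Proof. exact: linearD. Qed.

Lemma lin_eq V W (f g : {linear V -> W}) : f =1 g -> f = g.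
Proof.
case: f g => [f [[fa] [fb]]] [g [[ga] [gb]]] /= fg.
have E : f = g by apply: funext.
by subst g; rewrite (Prop_irrelevance ga fa) (Prop_irrelevance gb fb).
Qed.

End Linear.

Notation "g '∘' f" := (lcomp g f) (at level 50, format "g  '∘'  f").
Arguments idl {k V}.

Section Graded.
Variable k : fieldType.
Implicit Types (V W : complexType k) (U : lmodType k).

Definition ofdeg V (n : int) (v : V) : Prop := pr n v = v.

Definition supp V (v : V) : seq int := s2val (cid2 (pr_sum v)).

(* The linear map given by F n on V_n. *)
Definition gext V U (F : int -> V -> U) (v : V) : U :=
  \sum_(i <- supp v) F i (pr i v).

Lemma ofdeg_pr V n (v : V) : ofdeg n (pr n v).
Proof. by rewrite /ofdeg pr_pr eqxx. Qed.

Lemma ofdeg_pr0 V m n (v : V) : ofdeg n v -> pr m v = if m == n then v else 0.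
Proof. by move=> vn; rewrite -{1}vn pr_pr vn. Qed.

Lemma supp_uniq V (v : V) : uniq (supp v).
Proof. exact: (s2valP (cid2 (pr_sum v))). Qed.

Lemma supp_sum V (v : V) : v = \sum_(i <- supp v) pr i v.
Proof. exact: (s2valP' (cid2 (pr_sum v))). Qed.

Lemma sum_pr_out V (s : seq int) (w : int -> V) i :
  (forall j, ofdeg j (w j)) -> uniq s ->
  pr i (\sum_(j <- s) w j) = if i \in s then w i else 0.
Proof.
move=> wj us; rewrite linear_sum /=.
under eq_bigr do rewrite (ofdeg_pr0 _ (wj _)).
case: ifP => [si|/negbT si].
  rewrite (bigD1_seq i) //= eqxx big1 ?addr0 // => j /negbTE.
  by rewrite eq_sym => ->.
rewrite big_seq big1 // => j sj; case: eqP => // ij.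
by rewrite ij sj in si.
Qed.

Lemma supp_out V (v : V) i : i \notin supp v -> pr i v = 0.
Proof.
move=> /negbTE si; rewrite (supp_sum v) (@sum_pr_out V _ (fun j => pr j v)) ?si //.
  by move=> j; exact: ofdeg_pr.
exact: supp_uniq.
Qed.

Lemma big_sub (U : lmodType k) (s t : seq int) (F : int -> U) :
  uniq s -> uniq t -> (forall i, i \notin s -> F i = 0) ->
  (forall i, i \notin t -> F i = 0) ->
  \sum_(i <- s) F i = \sum_(i <- t) F i.
Proof.
move=> us ut Fs Ft.
have E (r r' : seq int) : uniq r -> uniq r' -> (forall i, i \notin r -> F i = 0) ->
    \sum_(i <- r') F i = \sum_(i <- r' | i \in r) F i.
  move=> _ _ H; rewrite (bigID (mem r)) /= [X in _ + X]big1 ?addr0 //.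
rewrite (E t s) // (E s t) // -[LHS]big_filter -[RHS]big_filter.
apply: perm_big; apply: uniq_perm; rewrite ?filter_uniq // => i.
by rewrite !mem_filter andbC.
Qed.

Lemma gext_sum V U (F : int -> V -> U) (v : V) (s : seq int) :
  (forall i, linear (F i)) -> uniq s -> (forall i, i \notin s -> pr i v = 0) ->
  gext F v = \sum_(i <- s) F i (pr i v).
Proof.
move=> Fl us sv.
have F0 i : F i 0 = 0 := linear0 (mklin (Fl i)).
apply: big_sub => //; first exact: supp_uniq.
  by move=> i /supp_out ->.
by move=> i /sv ->.
Qed.

Lemma gext_linear V U (F : int -> V -> U) :
  (forall i, linear (F i)) -> linear (gext F).
Proof.
move=> Fl a u v.
pose s := undup (supp u ++ supp v).
have us : uniq s by exact: undup_uniq.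
have su i : i \notin s -> pr i u = 0.
  by rewrite mem_undup mem_cat negb_or => /andP[/supp_out].
have sv i : i \notin s -> pr i v = 0.
  by rewrite mem_undup mem_cat negb_or => /andP[_ /supp_out].
rewrite (gext_sum Fl us su) (gext_sum Fl us sv) (gext_sum Fl us); last first.
  by move=> i si; rewrite linearP su // sv // scaler0 addr0.
rewrite scaler_sumr -big_split /=; apply: eq_bigr => i _.
by rewrite linearP Fl.
Qed.

Lemma gext_deg V U (F : int -> V -> U) n v :
  (forall i, linear (F i)) -> ofdeg n v -> gext F v = F n v.
Proof.
move=> Fl vn; rewrite (@gext_sum _ _ _ _ [:: n]) ?big_seq1 ?vn // => i.
by rewrite inE (ofdeg_pr0 _ vn) => /negbTE ->.
Qed.

Lemma gext_par V U (a : k) (F G H : int -> V -> U) v :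
  (forall i u, H i u = a *: F i u + G i u) ->
  gext H v = a *: gext F v + gext G v.
Proof.
move=> E; rewrite /gext scaler_sumr -big_split /=.
by apply: eq_bigr => i _; rewrite E.
Qed.

(* [sgn m v = (-1)^(m |v|) v] *)
Definition sgn_fun V (m : int) : V -> V := gext (fun n v => (-1) ^ (m * n) *: v).

Lemma sgn_linear V m : linear (@sgn_fun V m).
Proof.
apply: gext_linear => i a u v.
by rewrite scalerDr !scalerA mulrC.
Qed.

Definition sgn V (m : int) : {linear V -> V} := mklin (@sgn_linear V m).

Lemma sgn_deg V m n (v : V) : ofdeg n v -> sgn V m v = (-1) ^ (m * n) *: v.
Proof.
move=> vn; rewrite /sgn mklinE /sgn_fun (gext_deg _ vn) // => i a u w.
by rewrite scalerDr !scalerA mulrC.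
Qed.

Definition homog V W (n : int) (f : {linear V -> W}) : Prop :=
  forall i v, f (pr i v) = pr (i + n) (f v).

(* [conjs m f = (-1)^(m |f|) f], see [conjs_homog] *)
Definition conjs V W (m : int) (f : {linear V -> W}) : {linear V -> W} :=
  sgn W m ∘ f ∘ sgn V m.

(* The differential d f - (-1)^|f| f d of Hom(V, W), see [dHom_homog]. *)
Definition dHom V W (f : {linear V -> W}) : {linear V -> W} :=
  lsub (dif ∘ f) (conjs 1 f ∘ dif).

Definition chain_map V W (f : {linear V -> W}) : Prop :=
  homog 0 f /\ dif ∘ f =1 f ∘ dif.

Lemma homog_ofdeg V W n (f : {linear V -> W}) i v :
  homog n f -> ofdeg i v -> ofdeg (i + n) (f v).
Proof. by move=> fn vi; rewrite /ofdeg -fn vi. Qed.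

Lemma homogP V W n (f : {linear V -> W}) :
  (forall i v, ofdeg i v -> ofdeg (i + n) (f v)) -> homog n f.
Proof.
move=> H i v; rewrite {2}(supp_sum v) linear_sum linear_sum /=.
have fj j : ofdeg (j + n) (f (pr j v)) by apply/H/ofdeg_pr.
under eq_bigr do rewrite (ofdeg_pr0 _ (fj _)).
have [si|si] := boolP (i \in supp v).
  rewrite (bigD1_seq i) ?supp_uniq //= eqxx big1 ?addr0 // => j.
  by rewrite (inj_eq (addIr n)) eq_sym => /negbTE ->.
rewrite supp_out // linear0 big_seq big1 // => j sj.
by rewrite (inj_eq (addIr n)); case: eqP => // ij; rewrite ij sj in si.
Qed.

Lemma ext_deg V U (f g : {linear V -> U}) :
  (forall i v, ofdeg i v -> f v = g v) -> f =1 g.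
Proof.
move=> H v; rewrite (supp_sum v) !linear_sum; apply: eq_bigr => i _.
exact/H/ofdeg_pr.
Qed.

Lemma sgnN1 (m n : int) : (-1) ^ (m + n) = (-1) ^ m * (-1) ^ n :> k.
Proof. by apply: expfzDr; rewrite oppr_eq0 oner_eq0. Qed.

Lemma sgnsq (m : int) : (-1) ^ m * (-1) ^ m = 1 :> k.
Proof. by rewrite -expfzMl mulrNN mulr1 exp1rz. Qed.

Lemma conjs_homog V W m n (f : {linear V -> W}) v :
  homog n f -> conjs m f v = (-1) ^ (m * n) *: f v.
Proof.
move=> fn; pose g := lscale ((-1) ^ (m * n)) f.
suff : conjs m f =1 g by [].
apply: ext_deg => i u ui; rewrite /conjs !lcompE (sgn_deg _ ui) !linZ.
rewrite (sgn_deg _ (homog_ofdeg fn ui)) -[RHS]/((-1) ^ (m * n) *: f u).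
rewrite scalerA mulrDr sgnN1 mulrA sgnsq.
by rewrite mul1r.
Qed.

Lemma dHom_homog V W n (f : {linear V -> W}) v :
  homog n f -> dHom f v = dif (f v) - (-1) ^ n *: f (dif v).
Proof.
by move=> fn; have := conjs_homog 1 (dif v) fn; rewrite mul1r => <-.
Qed.

Lemma dif_ofdeg V n (v : V) : ofdeg n v -> ofdeg (n - 1) (dif v).
Proof. by move=> vn; rewrite /ofdeg -dif_pr vn. Qed.

Lemma homog_id V : homog 0 (@idl k V).
Proof. by move=> i v /=; rewrite addr0. Qed.

Lemma homog_comp (X V W : complexType k) m n (g : {linear V -> W}) (f : {linear X -> V}) :
  homog n g -> homog m f -> homog (m + n) (g ∘ f).
Proof. by move=> gn fm i v /=; rewrite fm gn addrA. Qed.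

Lemma chain_id V : chain_map (@idl k V).
Proof. by split=> //; exact: homog_id. Qed.

Lemma chain_comp (X V W : complexType k) (g : {linear V -> W}) (f : {linear X -> V}) :
  chain_map g -> chain_map f -> chain_map (g ∘ f).
Proof.
move=> [g0 gd] [f0 fd]; split; first by rewrite -[0]addr0; exact: homog_comp.
by move=> v /=; have /= -> := gd (f v); have /= -> := fd v.
Qed.

End Graded.

Definition bilin (k : fieldType) (V W U : lmodType k) (B : V -> W -> U) : Prop :=
  (forall w, linear (B^~ w)) /\ (forall v, linear (B v)).

(* The tensor product of V and W, as a quotient of the formal sums
   s = \sum_i v_i (x) w_i : two of them are identified when they have the same
   image under every bilinear map. Elements are canonical representatives;
   the universal property is [tlift], [tlift_pure], [tens_ext]. *)
Section TensModule.
Variables (k : fieldType) (V W : complexType k).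
Implicit Types (U : lmodType k) (s : seq (V * W)).

Definition fsum U (B : V -> W -> U) s : U := \sum_(p <- s) B p.1 p.2.

Definition fsum_eq s s' : bool :=
  `[< forall U (B : V -> W -> U), bilin B -> fsum B s = fsum B s' >].

Definition trepr s : seq (V * W) := choose (fsum_eq s) s.

Definition tens_car : Type := {s : seq (V * W) | trepr s == s}.
HB.instance Definition _ := Choice.on tens_car.

Lemma trepr_eq s U (B : V -> W -> U) : bilin B -> fsum B (trepr s) = fsum B s.
Proof.
have H : fsum_eq s s by apply/asboolP.
by move: (chooseP H) => /asboolP E bB; rewrite (E _ _ bB).
Qed.

Lemma eq_trepr s s' :
  (forall U (B : V -> W -> U), bilin B -> fsum B s = fsum B s') ->
  trepr s = trepr s'.
Proof.
move=> H; rewrite /trepr.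
have E : fsum_eq s =1 fsum_eq s'.
  move=> t; apply/asboolP/asboolP => T U B bB; first by rewrite -H // T.
  by rewrite H // T.
rewrite (eq_choose E); apply: choose_id; apply/asboolP => U B bB //.
by rewrite H.
Qed.

Lemma trepr_id s : trepr (trepr s) == trepr s.
Proof. by apply/eqP/eq_trepr => U B bB; rewrite trepr_eq. Qed.

Definition tcls s : tens_car := exist _ (trepr s) (trepr_id s).

Lemma fsum_tcls s U (B : V -> W -> U) : bilin B -> fsum B (val (tcls s)) = fsum B s.
Proof. exact: trepr_eq. Qed.

Lemma tens_car_eq (t u : tens_car) :
  (forall U (B : V -> W -> U), bilin B -> fsum B (val t) = fsum B (val u)) -> t = u.
Proof.
move=> H; apply: val_inj; rewrite -(eqP (valP t)) -(eqP (valP u)).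
exact: eq_trepr.
Qed.

Definition tens_add (t u : tens_car) := tcls (val t ++ val u).
Definition tens_zero := tcls [::].
Definition tens_scale (a : k) (t : tens_car) := tcls [seq (a *: p.1, p.2) | p <- val t].
Definition tens_opp (t : tens_car) := tens_scale (-1) t.

Section FsumTheory.
Variables (U : lmodType k) (B : V -> W -> U) (bB : bilin B).

Lemma bilin0l w : B 0 w = 0.
Proof. exact: (linear0 (mklin (bB.1 w))). Qed.

Lemma bilinZl a v w : B (a *: v) w = a *: B v w.
Proof. exact: (linZ (mklin (bB.1 w))). Qed.

Lemma fsum_add t u : fsum B (val (tens_add t u)) = fsum B (val t) + fsum B (val u).
Proof. by rewrite fsum_tcls // /fsum big_cat. Qed.

Lemma fsum_zero : fsum B (val tens_zero) = 0.
Proof. by rewrite fsum_tcls // /fsum big_nil. Qed.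

Lemma fsum_scale a t : fsum B (val (tens_scale a t)) = a *: fsum B (val t).
Proof.
rewrite fsum_tcls // /fsum big_map scaler_sumr.
by apply: eq_bigr => p _; rewrite bilinZl.
Qed.

Lemma fsum_opp t : fsum B (val (tens_opp t)) = - fsum B (val t).
Proof. by rewrite fsum_scale scaleN1r. Qed.

End FsumTheory.

Definition fsumE := (fsum_add, fsum_zero, fsum_scale, fsum_opp).

Fact tens_addA : associative tens_add.
Proof. by move=> t u v; apply: tens_car_eq => U B bB; rewrite !fsumE // addrA. Qed.
Fact tens_addC : commutative tens_add.
Proof. by move=> t u; apply: tens_car_eq => U B bB; rewrite !fsumE // addrC. Qed.
Fact tens_add0 : left_id tens_zero tens_add.
Proof. by move=> t; apply: tens_car_eq => U B bB; rewrite !fsumE // add0r. Qed.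
Fact tens_addN : left_inverse tens_zero tens_opp tens_add.
Proof. by move=> t; apply: tens_car_eq => U B bB; rewrite !fsumE // addNr. Qed.
HB.instance Definition _ :=
  GRing.isZmodule.Build tens_car tens_addA tens_addC tens_add0 tens_addN.

Fact tens_scaleA a b t : tens_scale a (tens_scale b t) = tens_scale (a * b) t.
Proof. by apply: tens_car_eq => U B bB; rewrite !fsumE // scalerA. Qed.
Fact tens_scale1 : left_id 1 tens_scale.
Proof. by move=> t; apply: tens_car_eq => U B bB; rewrite !fsumE // scale1r. Qed.
Fact tens_scaleDr : right_distributive tens_scale +%R.
Proof. by move=> a t u; apply: tens_car_eq => U B bB; rewrite !fsumE // scalerDr. Qed.
Fact tens_scaleDl t : {morph tens_scale^~ t : a b / a + b}.
Proof. by move=> a b; apply: tens_car_eq => U B bB; rewrite !fsumE // scalerDl. Qed.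
HB.instance Definition _ := GRing.Zmodule_isLmodule.Build k tens_car
  tens_scaleA tens_scale1 tens_scaleDr tens_scaleDl.

Definition pure0 (v : V) (w : W) : tens_car := tcls [:: (v, w)].

Fact fsum_linear U (B : V -> W -> U) (bB : bilin B) :
  linear (fun t : tens_car => fsum B (val t)).
Proof. by move=> a t u; rewrite (fsum_add bB) (fsum_scale bB). Qed.

Definition tlift0 U (B : V -> W -> U) (bB : bilin B) : {linear tens_car -> U} :=
  mklin (fsum_linear bB).

Lemma tlift0_pure U (B : V -> W -> U) (bB : bilin B) v w :
  tlift0 bB (pure0 v w) = B v w.
Proof. by rewrite /tlift0 mklinE fsum_tcls // /fsum big_seq1. Qed.

Lemma pure0_bilin : bilin pure0.
Proof.
split=> [w a v v'|v a w w']; apply: tens_car_eq => U B bB.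
  rewrite (fsum_add bB) (fsum_scale bB) !fsum_tcls // /fsum !big_seq1 /=.
  exact: bB.1.
rewrite (fsum_add bB) (fsum_scale bB) !fsum_tcls // /fsum !big_seq1 /=.
exact: bB.2.
Qed.

Lemma tens_car_sum (t : tens_car) : t = \sum_(p <- val t) pure0 p.1 p.2.
Proof.
apply: tens_car_eq => U B bB; rewrite -[RHS]/(tlift0 bB _) linear_sum.
by rewrite /fsum; apply: eq_bigr => p _; rewrite tlift0_pure.
Qed.

Lemma tens_car_ext U (f g : {linear tens_car -> U}) :
  (forall v w, f (pure0 v w) = g (pure0 v w)) -> f =1 g.
Proof.
move=> H t; rewrite (tens_car_sum t) !linear_sum.
by apply: eq_bigr => p _; rewrite H.
Qed.

End TensModule.

Lemma bilin_add (k : fieldType) (V W U : lmodType k) (B B' : V -> W -> U) :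
  bilin B -> bilin B' -> bilin (fun v w => B v w + B' v w).
Proof.
move=> [Bl Br] [Bl' Br']; split=> [w a v v'|v a w w'] /=.
  by rewrite Bl Bl' scalerDr addrACA.
by rewrite Br Br' scalerDr addrACA.
Qed.

Lemma bilin_comp (k : fieldType) (V W V' W' U : lmodType k) (B : V' -> W' -> U)
  (f : {linear V -> V'}) (g : {linear W -> W'}) :
  bilin B -> bilin (fun v w => B (f v) (g w)).
Proof.
move=> [Bl Br]; split=> [w a v v'|v a w w'] /=; first by rewrite linearP Bl.
by rewrite linearP Br.
Qed.

Lemma bilin_gext (k : fieldType) (V : complexType k) (W U : lmodType k)
  (B : int -> V -> W -> U) :
  (forall i, bilin (B i)) -> bilin (fun v w => gext (fun i u => B i u w) v).
Proof.
move=> bB; split=> [w|v a w w'].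
  by apply: gext_linear => i; exact: (bB i).1.
by apply: gext_par => i u; exact: (bB i).2.
Qed.

Section TensComplex.
Variables (k : fieldType) (V W : complexType k).
Local Notation T := (tens_car V W).

Fact tens_pr_bilin n :
  bilin (fun v w => gext (fun i (u : V) => pure0 u (pr (n - i) w)) v : T).
Proof.
by apply: bilin_gext => i; apply: (bilin_comp idl _ (pure0_bilin V W)).
Qed.

Fact tens_dif_bilin :
  bilin (fun v w => pure0 (dif v) w + pure0 (sgn V 1 v) (dif w) : T).
Proof.
apply: bilin_add; first exact: (bilin_comp _ idl (pure0_bilin V W)).
exact: (bilin_comp _ _ (pure0_bilin V W)).
Qed.

Definition tens_pr n : {linear T -> T} := tlift0 (tens_pr_bilin n).
Definition tens_dif : {linear T -> T} := tlift0 tens_dif_bilin.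

Lemma pure0_sum (v : V) (w : W) :
  pure0 v w = \sum_(i <- supp v) \sum_(j <- supp w) pure0 (pr i v) (pr j w).
Proof.
rewrite {1}(supp_sum v).
rewrite -[LHS]/(mklin ((pure0_bilin V W).1 w) _) linear_sum; apply: eq_bigr => i _.
rewrite mklinE {1}(supp_sum w).
by rewrite -[LHS]/(mklin ((pure0_bilin V W).2 (pr i v)) _) linear_sum.
Qed.

Lemma tens_car_ext_deg (U : lmodType k) (f g : {linear T -> U}) :
  (forall i j v w, ofdeg i v -> ofdeg j w -> f (pure0 v w) = g (pure0 v w)) ->
  f =1 g.
Proof.
move=> H; apply: tens_car_ext => v w; rewrite pure0_sum !linear_sum.
apply: eq_bigr => i _; rewrite !linear_sum; apply: eq_bigr => j _.
by apply: (H i j); exact: ofdeg_pr.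
Qed.

Lemma tens_pr_deg n i j (v : V) (w : W) : ofdeg i v -> ofdeg j w ->
  tens_pr n (pure0 v w) = if n == i + j then pure0 v w else 0.
Proof.
move=> vi wj; rewrite /tens_pr tlift0_pure (gext_deg _ vi); last first.
  by move=> l a x y; exact: (pure0_bilin V W).1.
rewrite (ofdeg_pr0 _ wj) subr_eq addrC; case: eqP => // _.
exact: (linear0 (mklin ((pure0_bilin V W).2 v))).
Qed.

Lemma tens_dif_deg i (v : V) (w : W) : ofdeg i v ->
  tens_dif (pure0 v w) = pure0 (dif v) w + (-1) ^ i *: pure0 v (dif w).
Proof.
move=> vi; rewrite /tens_dif tlift0_pure (sgn_deg _ vi) mul1r.
by rewrite (bilinZl (pure0_bilin V W)).
Qed.

Fact tens_pr_pr m n t : tens_pr m (tens_pr n t) = if m == n then tens_pr n t else 0.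
Proof.
pose F := if m == n then tens_pr n else lzero T T.
suff -> : tens_pr m (tens_pr n t) = F t by rewrite /F; case: eqP.
rewrite -lcompE; move: t; apply: tens_car_ext_deg => i j v w vi wj.
rewrite lcompE (tens_pr_deg n vi wj) /F.
case: (eqVneq m n) => [->|mn]; rewrite ?(tens_pr_deg n vi wj).
  by case: ifP => H; rewrite ?linear0 // (tens_pr_deg n vi wj) H.
case: ifP => [/eqP nij|]; rewrite ?linear0 // (tens_pr_deg m vi wj) -nij.
by rewrite (negbTE mn).
Qed.

Let good (t : T) := exists2 s : seq int, uniq s &
  forall r, uniq r -> {subset s <= r} -> t = \sum_(i <- r) tens_pr i t.

Let good_sum I (r : seq I) (F : I -> T) :
  (forall i, good (F i)) -> good (\sum_(i <- r) F i).
Proof.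
move=> gF; elim: r => [|i r [s us IH]].
  exists [::] => // r _ _; rewrite big_nil big1 // => i _; exact: linear0.
have [s' us' H] := gF i; exists (undup (s ++ s')); first exact: undup_uniq.
move=> q uq sq; rewrite big_cons.
under [RHS]eq_bigr do rewrite linearD.
rewrite big_split /= -IH // -?H // => j sj; apply: sq.
  by rewrite mem_undup mem_cat sj ?orbT.
by rewrite mem_undup mem_cat sj ?orbT.
Qed.

Fact tens_pr_sum t : exists2 s : seq int, uniq s & t = \sum_(i <- s) tens_pr i t.
Proof.
suff [s us H] : good t by exists s => //; exact: H.
rewrite (tens_car_sum t); apply: good_sum => -[v w] /=.
rewrite pure0_sum; apply: good_sum => i; apply: good_sum => j.
exists [:: i + j] => // r ur sr.
have rij : i + j \in r by apply: sr; rewrite inE.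
have E l : tens_pr l (pure0 (pr i v) (pr j w)) =
    if l == i + j then pure0 (pr i v) (pr j w) else 0.
  exact: (tens_pr_deg l (ofdeg_pr i v) (ofdeg_pr j w)).
under eq_bigr do rewrite E.
by rewrite (bigD1_seq (i + j) rij ur) /= eqxx big1 ?addr0 // => l /negbTE ->.
Qed.

Fact tens_dif_pr n t : tens_dif (tens_pr n t) = tens_pr (n - 1) (tens_dif t).
Proof.
rewrite -!lcompE; move: t; apply: tens_car_ext_deg => i j v w vi wj.
rewrite !lcompE (tens_pr_deg n vi wj) (tens_dif_deg w vi) linearD linZ.
rewrite (tens_pr_deg _ (dif_ofdeg vi) wj) (tens_pr_deg _ vi (dif_ofdeg wj)).
have -> : (n - 1 == i - 1 + j) = (n == i + j).
  by rewrite addrAC; exact: (inj_eq (addIr (-1))).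
have -> : (n - 1 == i + (j - 1)) = (n == i + j).
  by rewrite addrA; exact: (inj_eq (addIr (-1))).
case: eqP => [_|_]; first exact: tens_dif_deg.
by rewrite linear0 scaler0 addr0.
Qed.

Fact tens_dif_dif t : tens_dif (tens_dif t) = 0.
Proof.
rewrite -lcompE -[0]/(lzero T T t); move: t.
apply: tens_car_ext_deg => i j v w vi wj.
rewrite lcompE (tens_dif_deg w vi) linearD linZ (tens_dif_deg w (dif_ofdeg vi)).
rewrite (tens_dif_deg (dif w) vi) !dif_dif.
rewrite (bilin0l (pure0_bilin V W)) add0r.
rewrite -[pure0 v 0]/(mklin ((pure0_bilin V W).2 v) 0) linear0 !scaler0 addr0.
rewrite -scalerDl sgnN1 mulrC.
by rewrite -[(-1) ^ (-1)]/((-1)^-1) invrN1 mulN1r addNr scale0r.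
Qed.

HB.instance Definition _ :=
  isComplex.Build k T tens_pr_pr tens_pr_sum tens_dif_pr tens_dif_dif.

End TensComplex.

Definition tens (k : fieldType) (V W : complexType k) : complexType k :=
  tens_car V W.
Notation "V ⊗ W" := (tens V W) (at level 40, left associativity).

Definition pure (k : fieldType) (V W : complexType k) (v : V) (w : W) : V ⊗ W :=
  pure0 v w.
Notation "v ⊗ₜ w" := (pure v w) (at level 40, left associativity).

Section TensTheory.
Variable k : fieldType.
Implicit Types (V W X Y Z : complexType k) (U : lmodType k).

Definition tlift V W U (B : V -> W -> U) (bB : bilin B) : {linear V ⊗ W -> U} :=
  tlift0 bB.

Lemma tlift_pure V W U (B : V -> W -> U) (bB : bilin B) v w :
  tlift bB (v ⊗ₜ w) = B v w.
Proof. exact: tlift0_pure. Qed.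

Lemma pure_bilin V W : bilin (@pure k V W).
Proof. exact: pure0_bilin. Qed.

Definition purel V W (w : W) : {linear V -> V ⊗ W} :=
  mklin ((pure_bilin V W).1 w).
Definition purer V W (v : V) : {linear W -> V ⊗ W} :=
  mklin ((pure_bilin V W).2 v).

Lemma pureZl V W a (v : V) (w : W) : (a *: v) ⊗ₜ w = a *: (v ⊗ₜ w).
Proof. exact: (linZ (purel V w)). Qed.
Lemma pureZr V W a (v : V) (w : W) : v ⊗ₜ (a *: w) = a *: (v ⊗ₜ w).
Proof. exact: (linZ (purer W v)). Qed.
Lemma pureDl V W (u v : V) (w : W) : (u + v) ⊗ₜ w = u ⊗ₜ w + v ⊗ₜ w.
Proof. exact: (linD (purel V w)). Qed.
Lemma pureDr V W (v : V) (w x : W) : v ⊗ₜ (w + x) = v ⊗ₜ w + v ⊗ₜ x.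
Proof. exact: (linD (purer W v)). Qed.

Lemma tens_ext V W U (f g : {linear V ⊗ W -> U}) :
  (forall v w, f (v ⊗ₜ w) = g (v ⊗ₜ w)) -> f =1 g.
Proof. exact: tens_car_ext. Qed.

(* P contains enough elements to determine linear maps out of V. *)
Definition spans V (P : V -> Prop) : Prop :=
  forall U (f g : {linear V -> U}), (forall v, P v -> f v = g v) -> f =1 g.

Definition hom_elt V (v : V) : Prop := exists i, ofdeg i v.

Definition pure_of V W (P : V -> Prop) (Q : W -> Prop) (t : V ⊗ W) : Prop :=
  exists v w, [/\ P v, Q w & t = v ⊗ₜ w].

Lemma spans_hom V : spans (@hom_elt V).
Proof. by move=> U f g H; apply: ext_deg => i v vi; apply: H; exists i. Qed.

Lemma spans_pure V W (P : V -> Prop) (Q : W -> Prop) :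
  spans P -> spans Q -> spans (pure_of P Q).
Proof.
move=> sP sQ U f g H; apply: tens_ext => v w.
suff : f ∘ purer W v =1 g ∘ purer W v by exact.
apply: sQ => w' Qw'.
suff : f ∘ purel V w' =1 g ∘ purel V w' by exact.
by apply: sP => v' Pv'; apply: H; exists v', w'.
Qed.

Lemma pr_pure n i j V W (v : V) (w : W) : ofdeg i v -> ofdeg j w ->
  pr n (v ⊗ₜ w) = if n == i + j then v ⊗ₜ w else 0.
Proof. exact: tens_pr_deg. Qed.

Lemma ofdeg_pure i j V W (v : V) (w : W) : ofdeg i v -> ofdeg j w ->
  ofdeg (i + j) (v ⊗ₜ w).
Proof. by move=> vi wj; rewrite /ofdeg (pr_pure _ vi wj) eqxx. Qed.

Lemma dif_pure i V W (v : V) (w : W) : ofdeg i v ->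
  dif (v ⊗ₜ w) = dif v ⊗ₜ w + (-1) ^ i *: (v ⊗ₜ dif w).
Proof. exact: tens_dif_deg. Qed.

Lemma ofdegZ V n a (v : V) : ofdeg n v -> ofdeg n (a *: v).
Proof. by move=> vn; rewrite /ofdeg linearZ /= vn. Qed.

Lemma homog_spans V W n (P : V -> Prop) (f : {linear V -> W}) : spans P ->
  (forall v, P v -> exists2 i, ofdeg i v & ofdeg (i + n) (f v)) -> homog n f.
Proof.
move=> sP H i; suff : f ∘ pr i =1 pr (i + n) ∘ f by [].
apply: sP => v /H [j vj fj]; rewrite !lcompE (ofdeg_pr0 _ vj) (ofdeg_pr0 _ fj).
by rewrite (inj_eq (addIr n)); case: eqP => // _; rewrite linear0.
Qed.

(* The Koszul tensor product of linear maps: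
   (f (x) g) (v (x) w) = (-1)^(|g| |v|) f v (x) g w, see [tensM_deg]. *)
Lemma tensM_bilin V W X Y (f : {linear V -> X}) (g : {linear W -> Y}) :
  bilin (fun v w => gext (fun i u => f u ⊗ₜ conjs i g w) v).
Proof. by apply: bilin_gext => i; exact: bilin_comp (pure_bilin X Y). Qed.

Definition tensM V W X Y (f : {linear V -> X}) (g : {linear W -> Y}) :
  {linear V ⊗ W -> X ⊗ Y} := tlift (tensM_bilin f g).

Lemma tensM_deg V W X Y (f : {linear V -> X}) (g : {linear W -> Y}) n i v w :
  homog n g -> ofdeg i v ->
  tensM f g (v ⊗ₜ w) = (-1) ^ (n * i) *: (f v ⊗ₜ g w).
Proof.
move=> gn vi; rewrite /tensM tlift_pure (gext_deg _ vi).
  by rewrite (conjs_homog _ _ gn) pureZr mulrC.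
by move=> j a x y; rewrite linearP; exact: (pure_bilin X Y).1.
Qed.

Lemma tensM0 V W X Y (f : {linear V -> X}) (g : {linear W -> Y}) v w :
  homog 0 g -> tensM f g (v ⊗ₜ w) = f v ⊗ₜ g w.
Proof.
move=> g0; suff : tensM f g ∘ purel V w =1 purel X (g w) ∘ f by exact.
apply: ext_deg => i u ui; rewrite !lcompE.
by rewrite -[LHS]/(tensM f g (u ⊗ₜ w)) (tensM_deg _ _ g0 ui) mul0r scale1r.
Qed.

Lemma tau_bilin V W :
  bilin (fun (v : V) (w : W) => gext (fun i u => sgn W i w ⊗ₜ u) v).
Proof.
apply: bilin_gext => i; split=> [w a v v'|v a w w'].
  exact: (pure_bilin W V).2.
by rewrite linearP; exact: (pure_bilin W V).1.
Qed.

Definition tau V W : {linear V ⊗ W -> W ⊗ V} := tlift (@tau_bilin V W).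

Lemma tau_deg V W i j (v : V) (w : W) : ofdeg i v -> ofdeg j w ->
  tau V W (v ⊗ₜ w) = (-1) ^ (i * j) *: (w ⊗ₜ v).
Proof.
move=> vi wj; rewrite /tau tlift_pure (gext_deg _ vi).
  by rewrite (sgn_deg _ wj) pureZl.
by move=> l a x y; exact: (pure_bilin W V).2.
Qed.

Lemma assoc_bilin1 V W X (x : X) :
  bilin (fun (v : V) (w : W) => v ⊗ₜ (w ⊗ₜ x)).
Proof. exact: (bilin_comp idl (purel W x) (pure_bilin V (W ⊗ X))). Qed.

Lemma assoc_bilin V W X :
  bilin (fun (t : V ⊗ W) (x : X) => tlift (assoc_bilin1 V W x) t).
Proof.
split=> [x a t t'|t a x x']; first exact: linearP.
pose f := tlift (assoc_bilin1 V W (a *: x + x')).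
pose g := ladd (lscale a (tlift (assoc_bilin1 V W x))) (tlift (assoc_bilin1 V W x')).
rewrite -[LHS]/(f t) -[RHS]/(g t); move: t; apply: tens_ext => v w.
rewrite /f tlift_pure -[RHS]/(a *: tlift _ _ + tlift _ _) !tlift_pure.
by rewrite -(pure_bilin V _).2 -(pure_bilin W _).2.
Qed.

Definition assoc V W X : {linear (V ⊗ W) ⊗ X -> V ⊗ (W ⊗ X)} :=
  tlift (assoc_bilin V W X).

Lemma assoc_pure V W X (v : V) (w : W) (x : X) :
  assoc V W X ((v ⊗ₜ w) ⊗ₜ x) = v ⊗ₜ (w ⊗ₜ x).
Proof. by rewrite /assoc !tlift_pure. Qed.

Lemma associ_bilin1 V W X (v : V) :
  bilin (fun (w : W) (x : X) => (v ⊗ₜ w) ⊗ₜ x).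
Proof. exact: (bilin_comp (purer W v) idl (pure_bilin (V ⊗ W) X)). Qed.

Lemma associ_bilin V W X :
  bilin (fun (v : V) (t : W ⊗ X) => tlift (associ_bilin1 W X v) t).
Proof.
split=> [t a v v'|v a t t']; last exact: linearP.
pose f := tlift (associ_bilin1 W X (a *: v + v')).
pose g := ladd (lscale a (tlift (associ_bilin1 W X v))) (tlift (associ_bilin1 W X v')).
rewrite -[LHS]/(f t) -[RHS]/(g t); move: t; apply: tens_ext => w x.
rewrite /f tlift_pure -[RHS]/(a *: tlift _ _ + tlift _ _) !tlift_pure.
by rewrite -(pure_bilin _ X).1 -(pure_bilin V W).1.
Qed.

Definition associ V W X : {linear V ⊗ (W ⊗ X) -> (V ⊗ W) ⊗ X} :=
  tlift (associ_bilin V W X).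

Lemma associ_pure V W X (v : V) (w : W) (x : X) :
  associ V W X (v ⊗ₜ (w ⊗ₜ x)) = (v ⊗ₜ w) ⊗ₜ x.
Proof. by rewrite /associ !tlift_pure. Qed.

(* The map I (x) tau (x) I, up to reassociation of the fourfold products. *)
Definition mid V W X Y : {linear (V ⊗ W) ⊗ (X ⊗ Y) -> (V ⊗ X) ⊗ (W ⊗ Y)} :=
  associ V X (W ⊗ Y)
  ∘ tensM idl (assoc X W Y ∘ tensM (tau W X) idl ∘ associ W X Y)
  ∘ assoc V W (X ⊗ Y).

Lemma homog_tensM V W X Y m n (f : {linear V -> X}) (g : {linear W -> Y}) :
  homog m f -> homog n g -> homog (m + n) (tensM f g).
Proof.
move=> fm gn; apply: (homog_spans (spans_pure (@spans_hom V) (@spans_hom W))).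
move=> _ [v [w [[i vi] [j wj] ->]]]; exists (i + j); first exact: ofdeg_pure.
rewrite (tensM_deg _ _ gn vi); apply: ofdegZ; rewrite addrACA.
exact: ofdeg_pure (homog_ofdeg fm vi) (homog_ofdeg gn wj).
Qed.

Lemma chain_tensM V W X Y (f : {linear V -> X}) (g : {linear W -> Y}) :
  chain_map f -> chain_map g -> chain_map (tensM f g).
Proof.
move=> [f0 fd] [g0 gd]; split; first by rewrite -[0]addr0; exact: homog_tensM.
apply: (spans_pure (@spans_hom V) (@spans_hom W)).
move=> _ [v [w [[i vi] [j wj] ->]]].
have fv : ofdeg i (f v) by have := homog_ofdeg f0 vi; rewrite addr0.
rewrite !lcompE tensM0 // (dif_pure _ fv) (dif_pure _ vi).
rewrite (linD (tensM f g)) (linZ (tensM f g)) !tensM0 //.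
by have:= fd v; have:= gd w; rewrite !lcompE => -> ->.
Qed.

Lemma chain_tau V W : chain_map (tau V W).
Proof.
split.
  apply: (homog_spans (spans_pure (@spans_hom V) (@spans_hom W))).
  move=> _ [v [w [[i vi] [j wj] ->]]]; exists (i + j); first exact: ofdeg_pure.
  rewrite (tau_deg vi wj) addr0 addrC; apply: ofdegZ; exact: ofdeg_pure.
apply: (spans_pure (@spans_hom V) (@spans_hom W)).
move=> _ [v [w [[i vi] [j wj] ->]]].
rewrite !lcompE (tau_deg vi wj) (dif_pure _ vi) (linZ dif) (dif_pure _ wj).
rewrite (linD (tau V W)) (linZ (tau V W)).
rewrite (tau_deg (dif_ofdeg vi) wj) (tau_deg vi (dif_ofdeg wj)).
rewrite scalerDr !scalerA addrC mulrBl mulrBr mul1r mulr1 -!sgnN1.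
congr (_ *: _ + _ *: _); last by rewrite addrC subrK.
have E (a : int) : (-1) ^ (- a) = (-1) ^ a :> k 
  by rewrite -[LHS]mulr1 -[X in _ * X](sgnsq k a) mulrA -sgnN1 addNr expr0z mul1r.
by rewrite !sgnN1 E.
Qed.

Lemma chain_assoc V W X : chain_map (assoc V W X).
Proof.
have sp := spans_pure (spans_pure (@spans_hom V) (@spans_hom W)) (@spans_hom X).
split.
  apply: (homog_spans sp) => _ [_ [x [[v [w [[i vi] [j wj] ->]]] [l xl] ->]]].
  exists (i + j + l); first exact: ofdeg_pure (ofdeg_pure vi wj) xl.
  rewrite assoc_pure addr0 -addrA; exact: ofdeg_pure vi (ofdeg_pure wj xl).
apply: sp => _ [_ [x [[v [w [[i vi] [j wj] ->]]] [l xl] ->]]].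
rewrite !lcompE assoc_pure (dif_pure _ vi) (dif_pure _ wj).
rewrite (dif_pure _ (ofdeg_pure vi wj)) (dif_pure _ vi).
rewrite (linD (assoc V W X)) (linZ (assoc V W X)) assoc_pure.
rewrite !pureDl !pureDr !pureZl !pureZr.
by rewrite (linD (assoc V W X)) (linZ (assoc V W X)) !assoc_pure scalerDr addrA scalerA -sgnN1.
Qed.

Lemma associK V W X : cancel (associ V W X) (assoc V W X).
Proof.
have sp := spans_pure (@spans_hom V) (spans_pure (@spans_hom W) (@spans_hom X)).
suff : assoc V W X ∘ associ V W X =1 idl by [].
apply: sp => _ [v [_ [_ [w [x [_ _ ->]]] ->]]].
by rewrite lcompE associ_pure assoc_pure.
Qed.

Lemma assocK V W X : cancel (assoc V W X) (associ V W X).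
Proof.
have sp := spans_pure (spans_pure (@spans_hom V) (@spans_hom W)) (@spans_hom X).
suff : associ V W X ∘ assoc V W X =1 idl by [].
apply: sp => _ [_ [x [[v [w [_ _ ->]]] _ ->]]].
by rewrite lcompE assoc_pure associ_pure.
Qed.

Lemma chain_inv V W (f : {linear V -> W}) (g : {linear W -> V}) :
  cancel f g -> cancel g f -> chain_map f -> chain_map g.
Proof.
move=> fK gK [f0 fd]; split=> [i w|w].
  by rewrite -{1}(gK w) addr0 -[in LHS](addr0 i) -f0 fK.
by rewrite !lcompE -{2}(gK w); have := fd (g w); rewrite !lcompE => ->; rewrite fK.
Qed.

Lemma chain_associ V W X : chain_map (associ V W X).
Proof.
exact: chain_inv (@assocK V W X) (@associK V W X) (chain_assoc V W X).
Qed.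

Lemma chain_mid V W X Y : chain_map (mid V W X Y).
Proof.
apply: chain_comp; last exact: chain_assoc.
apply: chain_comp; first exact: chain_associ.
apply: chain_tensM; first exact: chain_id.
apply: chain_comp; last exact: chain_associ.
apply: chain_comp; first exact: chain_assoc.
by apply: chain_tensM; [exact: chain_tau | exact: chain_id].
Qed.

Lemma mid_deg V W X Y i j (v : V) (w : W) (x : X) (y : Y) :
  ofdeg i w -> ofdeg j x ->
  mid V W X Y ((v ⊗ₜ w) ⊗ₜ (x ⊗ₜ y)) = (-1) ^ (i * j) *: ((v ⊗ₜ x) ⊗ₜ (w ⊗ₜ y)).
Proof.
move=> wi xj; rewrite /mid !lcompE assoc_pure tensM0; last first.
  suff [] : chain_map (assoc X W Y ∘ tensM (tau W X) idl ∘ associ W X Y) by [].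
  apply: chain_comp; last exact: chain_associ.
  apply: chain_comp; first exact: chain_assoc.
  by apply: chain_tensM; [exact: chain_tau | exact: chain_id].
rewrite !lcompE associ_pure tensM0; last exact: homog_id.
by rewrite (tau_deg wi xj) pureZl linZ assoc_pure pureZr linZ associ_pure.
Qed.

End TensTheory.

Section Ground.
Variable k : fieldType.

Definition ground_pr (n : int) : {linear k^o -> k^o} :=
  if n == 0 then idl else lzero _ _.
Definition ground_dif : {linear k^o -> k^o} := lzero _ _.

Fact ground_pr_pr m n a :
  ground_pr m (ground_pr n a) = if m == n then ground_pr n a else 0.
Proof.
rewrite /ground_pr; case: (eqVneq m n) => [->|mn]; first by case: eqP.
case: (eqVneq n 0) mn => [->|_ _]; first by move=> /negbTE ->.
by case: eqP.
Qed.

Fact ground_pr_sum a : exists2 s : seq int, uniq s & a = \sum_(i <- s) ground_pr i a.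
Proof. by exists [:: 0] => //; rewrite big_seq1 /ground_pr eqxx. Qed.

Fact ground_dif_pr n a : ground_dif (ground_pr n a) = ground_pr (n - 1) (ground_dif a).
Proof. by rewrite linear0. Qed.

Fact ground_dif_dif a : ground_dif (ground_dif a) = 0.
Proof. by []. Qed.

HB.instance Definition _ :=
  isComplex.Build k k^o ground_pr_pr ground_pr_sum ground_dif_pr ground_dif_dif.

Definition ground : complexType k := k^o.

Lemma iota_bilin (V : complexType k) : bilin (fun (a : ground) (v : V) => (a : k) *: v).
Proof.
split=> [v a b c|b a v w]; first by rewrite scalerDl scalerA.
by rewrite scalerDr !scalerA mulrC.
Qed.

Definition iota (V : complexType k) : {linear ground ⊗ V -> V} :=
  tlift (iota_bilin V).

Lemma iota_pure (V : complexType k) a (v : V) : iota V ((a : ground) ⊗ₜ v) = (a : k) *: v.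
Proof. exact: tlift_pure. Qed.

Lemma ofdeg_ground i (a : ground) : ofdeg i a -> i = 0 \/ a = 0.
Proof.
rewrite /ofdeg -[pr i a]/(ground_pr i a) /ground_pr.
by case: (eqVneq i 0) => [|_ <-]; [left | right].
Qed.

Lemma ofdeg0_ground (a : ground) : ofdeg 0 a.
Proof. by rewrite /ofdeg -[pr 0 a]/(ground_pr 0 a) /ground_pr eqxx. Qed.

Lemma spans_ground : spans (fun a : ground => a = 1).
Proof.
move=> U f g H a; have -> : a = (a : k) *: (1 : ground) by rewrite /GRing.scale /= mulr1.
by rewrite !linZ H.
Qed.

Lemma chain_iota V : chain_map (iota V).
Proof.
have sp := spans_pure spans_ground (@spans_hom k V).
have o0 := ofdeg0_ground 1; split.
  apply: (homog_spans sp) => _ [_ [v [-> [i vi] ->]]]; exists (0 + i).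
    exact: ofdeg_pure.
  by rewrite iota_pure scale1r add0r addr0.
apply: sp => _ [_ [v [-> [i vi] ->]]].
rewrite !lcompE (dif_pure _ o0) expr0z !iota_pure !scale1r.
by rewrite (linD (iota V)) !iota_pure scale0r add0r scale1r.
Qed.

End Ground.
Arguments ground : clear implicits.

(* A dg-algebra A = \bigoplus_n A_n, given by an ambient k-module [dga_car]
   and its submodules A_n = [dga_deg n]; the elements of A are the finite sums
   of homogeneous ones, [total]. The module structure is part of the record
   because the carrier of E_omega(C) is too large (in the sense of universes)
   to be an [lmodType]. *)
Record dgaData (k : fieldType) := DgaData {
  dga_car :> Type;
  dga_zero : dga_car;
  dga_add : dga_car -> dga_car -> dga_car;
  dga_scale : k -> dga_car -> dga_car;
  dga_deg : int -> dga_car -> Prop;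
  dga_one : dga_car;
  dga_mul : dga_car -> dga_car -> dga_car;
  dga_dif : dga_car -> dga_car
}.
Arguments dga_zero {k}.
Arguments dga_one {k}.

Inductive total (k : fieldType) (A : dgaData k) : A -> Prop :=
| total0 : total (dga_zero A)
| totalD n x y : dga_deg n x -> total y -> total (dga_add x y).

Record is_dga (k : fieldType) (A : dgaData k) : Prop := IsDga {
  dga_addA : associative (@dga_add k A);
  dga_addC : commutative (@dga_add k A);
  dga_add0 : left_id (dga_zero A) (@dga_add k A);
  dga_addN : forall x : A, dga_add (dga_scale (-1) x) x = dga_zero A;
  dga_scaleA : forall a b (x : A), dga_scale a (dga_scale b x) = dga_scale (a * b) x;
  dga_scale1 : left_id 1 (@dga_scale k A);
  dga_scaleDr : forall a (x y : A),
    dga_scale a (dga_add x y) = dga_add (dga_scale a x) (dga_scale a y);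
  dga_scaleDl : forall a b (x : A),
    dga_scale (a + b) x = dga_add (dga_scale a x) (dga_scale b x);
  dga_deg0 : forall n, dga_deg n (dga_zero A);
  dga_degD : forall n (x y : A), dga_deg n x -> dga_deg n y -> dga_deg n (dga_add x y);
  dga_degZ : forall n a (x : A), dga_deg n x -> dga_deg n (dga_scale a x);
  dga_direct : forall (s : seq int) (x : int -> A), uniq s ->
    (forall i, dga_deg i (x i)) ->
    \big[@dga_add k A/dga_zero A]_(i <- s) x i = dga_zero A ->
    forall i, i \in s -> x i = dga_zero A;
  dga_deg_one : dga_deg 0 (dga_one A);
  dga_deg_mul : forall m n (x y : A),
    dga_deg m x -> dga_deg n y -> dga_deg (m + n) (dga_mul x y);
  dga_mul_linl : forall a (x y z : A), total x -> total y -> total z ->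
    dga_mul (dga_add (dga_scale a x) y) z =
    dga_add (dga_scale a (dga_mul x z)) (dga_mul y z);
  dga_mul_linr : forall a (x y z : A), total x -> total y -> total z ->
    dga_mul x (dga_add (dga_scale a y) z) =
    dga_add (dga_scale a (dga_mul x y)) (dga_mul x z);
  dga_mulA : forall x y z : A, total x -> total y -> total z ->
    dga_mul x (dga_mul y z) = dga_mul (dga_mul x y) z;
  dga_mul1l : forall x : A, total x -> dga_mul (dga_one A) x = x;
  dga_mul1r : forall x : A, total x -> dga_mul x (dga_one A) = x;
  dga_deg_dif : forall n (x : A), dga_deg n x -> dga_deg (n - 1) (dga_dif x);
  dga_dif_lin : forall a (x y : A), total x -> total y ->
    dga_dif (dga_add (dga_scale a x) y) = dga_add (dga_scale a (dga_dif x)) (dga_dif y);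
  dga_dif_dif : forall x : A, total x -> dga_dif (dga_dif x) = dga_zero A;
  dga_dif_mul : forall n (x y : A), dga_deg n x -> total y ->
    dga_dif (dga_mul x y) =
    dga_add (dga_mul (dga_dif x) y) (dga_scale ((-1) ^ n) (dga_mul x (dga_dif y)))
}.

Record is_dga_mor (k : fieldType) (A B : dgaData k) (F : A -> B) : Prop := IsDgaMor {
  dga_mor_deg : forall n (x : A), dga_deg n x -> dga_deg n (F x);
  dga_mor_lin : forall a (x y : A), total x -> total y ->
    F (dga_add (dga_scale a x) y) = dga_add (dga_scale a (F x)) (F y);
  dga_mor_one : F (dga_one A) = dga_one B;
  dga_mor_mul : forall x y : A, total x -> total y -> F (dga_mul x y) = dga_mul (F x) (F y);
  dga_mor_dif : forall x : A, total x -> F (dga_dif x) = dga_dif (F x)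
}.

Section Hopf.
Variable k : fieldType.

Definition complex_dga (A : complexType k) (one : A) (mul : A -> A -> A) : dgaData k :=
  {| dga_car := A; dga_zero := 0; dga_add := +%R; dga_scale := *:%R;
     dga_deg := @ofdeg k A; dga_one := one; dga_mul := mul; dga_dif := @dif k A |}.

Lemma total_complex (A : complexType k) (one : A) (mul : A -> A -> A)
  (x : complex_dga one mul) : total x.
Proof.
rewrite (supp_sum (x : A)); elim: (supp _) => [|i s IH].
  rewrite big_nil; exact: total0.
by rewrite big_cons; apply: (@totalD k (complex_dga one mul) i) => //; exact: ofdeg_pr.
Qed.

Definition ground_dga : dgaData k := @complex_dga (ground k) 1 *%R.

(* The tensor square of the dg-algebra (A, u, m). *)
Definition tens_dga (A : complexType k) (u : {linear ground k -> A})
    (m : {linear A ⊗ A -> A}) : dgaData k :=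
  @complex_dga (A ⊗ A) (u 1 ⊗ₜ u 1)
    (fun s t => tensM m m (mid A A A A (s ⊗ₜ t))).

Record ccdgCoalg := CcdgCoalg {
  coalg :> complexType k;
  counit : {linear coalg -> ground k};
  comul : {linear coalg -> coalg ⊗ coalg};
  counit_chain : chain_map counit;
  comul_chain : chain_map comul;
  comulA : assoc coalg coalg coalg ∘ tensM comul idl ∘ comul =1 tensM idl comul ∘ comul;
  counitl : iota coalg ∘ tensM counit idl ∘ comul =1 idl;
  counitr : iota coalg ∘ tau coalg (ground k) ∘ tensM idl counit ∘ comul =1 idl;
  comulC : tau coalg coalg ∘ comul =1 comul
}.

Record is_coalg_mor (C C' : ccdgCoalg) (f : {linear C -> C'}) : Prop := IsCoalgMor {
  coalg_mor_chain : chain_map f;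
  coalg_mor_counit : counit C' ∘ f =1 counit C;
  coalg_mor_comul : comul C' ∘ f =1 tensM f f ∘ comul C
}.

(* The dg-algebra axioms say that the unit and the product are chain maps of
   degree 0 (see [hmul_chain]). *)
Record ccdgHopf := CcdgHopf {
  hopf :> ccdgCoalg;
  hunit : {linear ground k -> hopf};
  hmul : {linear hopf ⊗ hopf -> hopf};
  antipode : {linear hopf -> hopf};
  hopf_dga := @complex_dga hopf (hunit 1) (fun x y => hmul (x ⊗ₜ y));
  hopf_is_dga : is_dga hopf_dga;
  counit_mor : @is_dga_mor k hopf_dga ground_dga (counit hopf);
  comul_mor : @is_dga_mor k hopf_dga (tens_dga hunit hmul) (comul hopf);
  antipode_homog : homog 0 antipode;
  antipodel : hmul ∘ tensM antipode idl ∘ comul hopf =1 hunit ∘ counit hopf;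
  antipoder : hmul ∘ tensM idl antipode ∘ comul hopf =1 hunit ∘ counit hopf
}.

Record dgMod (H : ccdgHopf) := DgMod {
  dgmod :> complexType k;
  act : {linear H ⊗ dgmod -> dgmod};
  act_chain : chain_map act;
  actA : act ∘ tensM (hmul H) idl =1 act ∘ tensM idl act ∘ assoc H H dgmod;
  act1 : forall v, act (hunit H 1 ⊗ₜ v) = v
}.

Section Modules.
Variable H : ccdgHopf.
Local Notation u := (hunit H).
Local Notation m := (hmul H).

Definition is_mod_mor (M M' : dgMod H) (psi : {linear M -> M'}) : Prop :=
  psi ∘ act M =1 act M' ∘ tensM idl psi.

Lemma hmul_homog : homog 0 m.
Proof.
apply: (homog_spans (spans_pure (@spans_hom k H) (@spans_hom k H))).
move=> _ [x [y [[i xi] [j yj] ->]]]; exists (i + j); first exact: ofdeg_pure.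
by rewrite addr0; exact: (dga_deg_mul (hopf_is_dga H) xi yj).
Qed.

Lemma hmul_deg i j (x y : H) : ofdeg i x -> ofdeg j y -> ofdeg (i + j) (m (x ⊗ₜ y)).
Proof. exact: (dga_deg_mul (hopf_is_dga H)). Qed.

Lemma hmul_chain : chain_map m.
Proof.
split; first exact: hmul_homog.
apply: (spans_pure (@spans_hom k H) (@spans_hom k H)).
move=> _ [x [y [[i xi] [j yj] ->]]].
rewrite !lcompE (dif_pure _ xi) (linD m) (linZ m).
exact: (dga_dif_mul (hopf_is_dga H) xi (total_complex y)).
Qed.

Lemma hmulA x y z : m (x ⊗ₜ m (y ⊗ₜ z)) = m (m (x ⊗ₜ y) ⊗ₜ z).
Proof. by apply: (dga_mulA (hopf_is_dga H)); exact: total_complex. Qed.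

Lemma hmul1l x : m (u 1 ⊗ₜ x) = x.
Proof. exact: (dga_mul1l (hopf_is_dga H) (total_complex x)). Qed.

Lemma hunit_deg : ofdeg 0 (u 1).
Proof. exact: (dga_deg_one (hopf_is_dga H)). Qed.

Lemma comul_mul x y : comul H (m (x ⊗ₜ y)) =
  tensM m m (mid H H H H (comul H x ⊗ₜ comul H y)).
Proof. by apply: (dga_mor_mul (comul_mor H)); exact: total_complex. Qed.

Lemma comul_one : comul H (u 1) = u 1 ⊗ₜ u 1.
Proof. exact: (dga_mor_one (comul_mor H)). Qed.

Lemma counit_mul x y : counit H (m (x ⊗ₜ y)) = counit H x * counit H y :> k.
Proof. by apply: (dga_mor_mul (counit_mor H)); exact: total_complex. Qed.

Lemma counit_one : counit H (u 1) = 1.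
Proof. exact: (dga_mor_one (counit_mor H)). Qed.

Definition unit_act : {linear H ⊗ ground k -> ground k} :=
  iota (ground k) ∘ tensM (counit H) idl.

Fact unit_act_chain : chain_map unit_act.
Proof.
apply: chain_comp; first exact: chain_iota.
by apply: chain_tensM; [exact: counit_chain | exact: chain_id].
Qed.

Lemma unit_act_pure x (a : ground k) : unit_act (x ⊗ₜ a) = (counit H x : k) *: a.
Proof. by rewrite /unit_act lcompE tensM0 ?iota_pure //; exact: homog_id. Qed.

Fact unit_actA :
  unit_act ∘ tensM m idl =1 unit_act ∘ tensM idl unit_act ∘ assoc H H (ground k).
Proof.
have sp := spans_pure (spans_pure (@spans_hom k H) (@spans_hom k H)) (@spans_hom k (ground k)).
apply: sp => _ [_ [a [[x [y [_ _ ->]]] _ ->]]].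
rewrite -[LHS]/(unit_act (tensM m idl _)) -[RHS]/(unit_act (tensM idl unit_act (assoc _ _ _ _))).
rewrite assoc_pure (tensM0 _ _ _ (@homog_id _ _))
  (tensM0 _ _ _ unit_act_chain.1).
by rewrite !unit_act_pure counit_mul scalerA.
Qed.

Fact unit_act1 (a : ground k) : unit_act (u 1 ⊗ₜ a) = a.
Proof. by rewrite unit_act_pure counit_one scale1r. Qed.

Definition unit_mod : dgMod H := DgMod unit_act_chain unit_actA unit_act1.

Variables M N : dgMod H.

Definition tens_act : {linear H ⊗ (M ⊗ N) -> M ⊗ N} :=
  tensM (act M) (act N) ∘ mid H H M N ∘ tensM (comul H) idl.

Fact tens_act_chain : chain_map tens_act.
Proof.
apply: chain_comp.
  apply: chain_comp; last exact: chain_mid.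
  by apply: chain_tensM; exact: act_chain.
by apply: chain_tensM; [exact: comul_chain | exact: chain_id].
Qed.

Let A : {linear (H ⊗ H) ⊗ (M ⊗ N) -> M ⊗ N} := tensM (act M) (act N) ∘ mid H H M N.

Let A_chain : chain_map A.
Proof.
apply: chain_comp; last exact: chain_mid.
by apply: chain_tensM; exact: act_chain.
Qed.

Let tens_actE x n : tens_act (x ⊗ₜ n) = A (comul H x ⊗ₜ n).
Proof. by rewrite /tens_act lcompE tensM0 //; exact: homog_id. Qed.

Let A_pure i j x y v w : ofdeg i y -> ofdeg j v ->
  A ((x ⊗ₜ y) ⊗ₜ (v ⊗ₜ w)) = (-1) ^ (i * j) *: (act M (x ⊗ₜ v) ⊗ₜ act N (y ⊗ₜ w)).
Proof.
move=> yi vj; rewrite /A lcompE (mid_deg _ _ yi vj) (linZ (tensM _ _)) tensM0 //.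
exact: (act_chain N).1.
Qed.

Let actAE (P : dgMod H) x y v : act P (m (x ⊗ₜ y) ⊗ₜ v) = act P (x ⊗ₜ act P (y ⊗ₜ v)).
Proof.
have := @actA H P ((x ⊗ₜ y) ⊗ₜ v); rewrite !lcompE assoc_pure (tensM0 _ _ _ (@homog_id _ _)).
by rewrite (tensM0 _ _ _ (act_chain P).1).
Qed.

Let act_deg (P : dgMod H) i j x (v : P) : ofdeg i x -> ofdeg j v ->
  ofdeg (i + j) (act P (x ⊗ₜ v)).
Proof.
move=> xi vj; have := homog_ofdeg (act_chain P).1 (ofdeg_pure xi vj).
by rewrite addr0.
Qed.

Let B : {linear (H ⊗ H) ⊗ (H ⊗ H) -> H ⊗ H} := tensM m m ∘ mid H H H H.

Let B_pure i j a b c d : ofdeg i b -> ofdeg j c ->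
  B ((a ⊗ₜ b) ⊗ₜ (c ⊗ₜ d)) = (-1) ^ (i * j) *: (m (a ⊗ₜ c) ⊗ₜ m (b ⊗ₜ d)).
Proof.
move=> bi cj; rewrite /B lcompE (mid_deg _ _ bi cj) (linZ (tensM _ _)).
by rewrite (tensM0 _ _ _ hmul_homog).
Qed.

Let AA s t n : A (B (s ⊗ₜ t) ⊗ₜ n) = A (s ⊗ₜ A (t ⊗ₜ n)).
Proof.
have sH := spans_pure (@spans_hom k H) (@spans_hom k H).
have sp := spans_pure (spans_pure sH sH) (spans_pure (@spans_hom k M) (@spans_hom k N)).
suff E : A ∘ tensM B idl =1 A ∘ (tensM idl A ∘ assoc _ _ _).
  move: (E ((s ⊗ₜ t) ⊗ₜ n)).
  rewrite -[LHS]/(A (tensM B idl _)) -[RHS]/(A (tensM idl A (assoc _ _ _ _))).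
  by rewrite assoc_pure (tensM0 _ _ _ (@homog_id _ _)) (tensM0 _ _ _ A_chain.1).
apply: sp => _ [_ [_ [[_ [_ [[a [b [[ia ai] [ib bi] ->]]]
  [c [d [[ic ci] [id di] ->]]] ->]]] [v [w [[iv vi] [iw wi] ->]]] ->]]].
rewrite -[LHS]/(A (tensM B idl _)) -[RHS]/(A (tensM idl A (assoc _ _ _ _))).
rewrite assoc_pure (tensM0 _ _ _ (@homog_id _ _)) (tensM0 _ _ _ A_chain.1).
rewrite (B_pure _ _ bi ci) pureZl (linZ A) (A_pure _ _ (hmul_deg bi di) vi).
rewrite (A_pure _ _ di vi) pureZr (linZ A) (A_pure _ _ bi (act_deg ci vi)).
rewrite !scalerA !actAE -!sgnN1; congr ((-1) ^ _ *: _).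
by rewrite mulrDl mulrDr addrA addrC.
Qed.

Fact tens_actA :
  tens_act ∘ tensM m idl =1 tens_act ∘ tensM idl tens_act ∘ assoc H H (M ⊗ N).
Proof.
have sp := spans_pure (spans_pure (@spans_hom k H) (@spans_hom k H))
  (@spans_hom k (M ⊗ N)).
apply: sp => _ [_ [n [[x [y [_ _ ->]]] _ ->]]].
rewrite -[LHS]/(tens_act (tensM m idl _)) -[RHS]/(tens_act (tensM idl tens_act (assoc _ _ _ _))).
rewrite assoc_pure (tensM0 _ _ _ (@homog_id _ _))
  (tensM0 _ _ _ tens_act_chain.1).
rewrite !tens_actE comul_mul; exact: AA.
Qed.

Fact tens_act1 n : tens_act (u 1 ⊗ₜ n) = n.
Proof.
rewrite tens_actE comul_one.
suff : A ∘ purer (M ⊗ N) (u 1 ⊗ₜ u 1) =1 idl by exact.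
apply: (spans_pure (@spans_hom k M) (@spans_hom k N)).
move=> _ [v [w [[i vi] _ ->]]]; rewrite lcompE.
rewrite -[LHS]/(A ((u 1 ⊗ₜ u 1) ⊗ₜ (v ⊗ₜ w))) (A_pure _ _ hunit_deg vi) mul0r.
by rewrite expr0z scale1r !act1.
Qed.

Definition tens_mod : dgMod H := DgMod tens_act_chain tens_actA tens_act1.

End Modules.
End Hopf.

(* A category of structured sets: an object is presented by an ambient type
   [cel] and the subset [cmem] of its actual elements, so that morphisms (and
   equality of morphisms) only matter on [cmem]. [cobj] and [cmor] single out
   the data which satisfy the axioms. *)
Record concreteCat := ConcreteCat {
  cdata : Type;
  cel : cdata -> Type;
  cmem : forall A : cdata, cel A -> Prop;
  cobj : cdata -> Prop;
  cmor : forall A B : cdata, (cel A -> cel B) -> Prop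
}.

Definition dgA (k : fieldType) : concreteCat :=
  {| cdata := dgaData k; cel := @dga_car k; cmem := @total k;
     cobj := @is_dga k; cmor := @is_dga_mor k |}.

Record grpData := GrpData {
  grp_car :> Type;
  grp_mem : grp_car -> Prop;
  grp_one : grp_car;
  grp_mul : grp_car -> grp_car -> grp_car
}.

Record is_grp (G : grpData) : Prop := IsGrp {
  grp_mem_one : grp_mem (grp_one G);
  grp_mem_mul : forall x y : G, grp_mem x -> grp_mem y -> grp_mem (grp_mul x y);
  grp_mulA : forall x y z : G, grp_mem x -> grp_mem y -> grp_mem z ->
    grp_mul x (grp_mul y z) = grp_mul (grp_mul x y) z;
  grp_mul1l : forall x : G, grp_mem x -> grp_mul (grp_one G) x = x;
  grp_mul1r : forall x : G, grp_mem x -> grp_mul x (grp_one G) = x;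
  grp_inv : forall x : G, grp_mem x -> exists y : G,
    [/\ grp_mem y, grp_mul x y = grp_one G & grp_mul y x = grp_one G]
}.

Definition is_grp_mor (G G' : grpData) (F : G -> G') : Prop :=
  (forall x, grp_mem x -> grp_mem (F x)) /\
  (forall x y, grp_mem x -> grp_mem y -> F (grp_mul x y) = grp_mul (F x) (F y)).

Definition Grp : concreteCat :=
  {| cdata := grpData; cel := grp_car; cmem := grp_mem;
     cobj := is_grp; cmor := is_grp_mor |}.

Definition SetCat : concreteCat :=
  {| cdata := {T : Type & T -> Prop}; cel := @projT1 _ _;
     cmem := @projT2 Type (fun T => T -> Prop); cobj := fun=> True;
     cmor := fun A B F => forall x, projT2 A x -> projT2 B (F x) |}.

Section Presheaves.
Variables (k : fieldType) (K : concreteCat).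

Record presheafData := PresheafData {
  pob :> ccdgCoalg k -> cdata K;
  pmap : forall C C' : ccdgCoalg k, {linear C -> C'} -> cel (pob C') -> cel (pob C)
}.

Arguments pmap : clear implicits.
Arguments pmap p {C C'} f x.

Record is_presheaf (F : presheafData) : Prop := IsPresheaf {
  presheaf_obj : forall C, cobj (F C);
  presheaf_mor : forall (C C' : ccdgCoalg k) (f : {linear C -> C'}),
    is_coalg_mor f -> cmor (pmap F f);
  presheaf_id : forall (C : ccdgCoalg k) (x : cel (F C)),
    cmem x -> pmap F idl x = x;
  presheaf_comp : forall (C C' C'' : ccdgCoalg k)
      (g : {linear C' -> C''}) (f : {linear C -> C'}) (x : cel (F C'')),
    is_coalg_mor g -> is_coalg_mor f -> cmem x ->
    pmap F (g ∘ f) x = pmap F f (pmap F g x)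
}.

Definition is_nat_trans (F G : presheafData)
    (Phi : forall C, cel (F C) -> cel (G C)) : Prop :=
  (forall C, cmor (Phi C)) /\
  (forall (C C' : ccdgCoalg k) (f : {linear C -> C'}) (x : cel (F C')),
     is_coalg_mor f -> cmem x -> Phi C (pmap F f x) = pmap G f (Phi C' x)).

Definition nat_iso (F G : presheafData) : Prop :=
  exists (Phi : forall C, cel (F C) -> cel (G C))
         (Psi : forall C, cel (G C) -> cel (F C)),
    [/\ is_nat_trans Phi, is_nat_trans Psi,
        forall C x, cmem x -> Psi C (Phi C x) = x &
        forall C y, cmem y -> Phi C (Psi C y) = y].

End Presheaves.
Arguments is_presheaf {k K}.
Arguments nat_iso {k K}.

Definition forget_grp (k : fieldType) (F : presheafData k Grp) : presheafData k SetCat :=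
  @PresheafData k SetCat
    (fun C => existT (fun T : Type => T -> Prop) (grp_car (F C)) (@grp_mem (F C)))
    (@pmap k Grp F).

Definition yoneda (k : fieldType) (D : ccdgCoalg k) : presheafData k SetCat :=
  @PresheafData k SetCat
    (fun C => existT (fun T : Type => T -> Prop) {linear C -> D} (@is_coalg_mor k C D))
    (fun C C' f g => g ∘ f).

Section Convolution.
Variables (k : fieldType) (H : ccdgHopf k).

Definition conv (C : ccdgCoalg k) (a b : {linear C -> H}) : {linear C -> H} :=
  hmul H ∘ tensM a b ∘ comul C.

(* As for any [dgaData], the elements are the sums of homogeneous ones, here
   the direct sum of the Hom(C, Omega)_n. *)
Definition E_Omega_ob (C : ccdgCoalg k) : dgaData k :=
  {| dga_car := {linear C -> H}; dga_zero := lzero C H; dga_add := @ladd k C H;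
     dga_scale := @lscale k C H; dga_deg := @homog k C H;
     dga_one := hunit H ∘ counit C; dga_mul := @conv C; dga_dif := @dHom k C H |}.

Definition E_Omega : presheafData k (dgA k) :=
  @PresheafData k (dgA k) E_Omega_ob (fun C C' f a => a ∘ f).

Definition P_Omega_ob (C : ccdgCoalg k) : grpData :=
  {| grp_car := {linear C -> H}; grp_mem := @is_coalg_mor k C H;
     grp_one := hunit H ∘ counit C; grp_mul := @conv C |}.

Definition P_Omega : presheafData k Grp :=
  @PresheafData k Grp P_Omega_ob (fun C C' f g => g ∘ f).

End Convolution.

Section EndOmega.
Variables (k : fieldType) (H : ccdgHopf k).

Section Comodule.
Variable C : ccdgCoalg k.
Implicit Types V W : complexType k.

(* Delta_C (x) I, the coaction of the cofree comodule C (x) V. *)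
Definition coact V : {linear C ⊗ V -> C ⊗ (C ⊗ V)} :=
  assoc C C V ∘ tensM (comul C) idl.

Definition is_comod_map V W (phi : {linear C ⊗ V -> C ⊗ W}) : Prop :=
  coact W ∘ phi =1 tensM idl phi ∘ coact V.

Definition qcheck V W (phi : {linear C ⊗ V -> C ⊗ W}) : {linear C ⊗ V -> W} :=
  iota W ∘ tensM (counit C) idl ∘ phi.

Definition tens_comod V W V' W' (phi : {linear C ⊗ V -> C ⊗ W})
    (phi' : {linear C ⊗ V' -> C ⊗ W'}) :
    {linear C ⊗ (V ⊗ V') -> C ⊗ (W ⊗ W')} :=
  assoc C W W' ∘ tensM phi (qcheck phi') ∘ mid C C V V' ∘ tensM (comul C) idl.

Definition fam : Type := forall M : dgMod H, {linear C ⊗ M -> C ⊗ M}.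

(* Elements of degree n of End(C (x) omega). *)
Definition is_end (n : int) (eta : fam) : Prop :=
  [/\ forall M, homog n (eta M),
      forall M, is_comod_map (eta M) &
      forall (M M' : dgMod H) (p : int) (psi : {linear M -> M'}),
        homog p psi -> is_mod_mor psi ->
        tensM idl psi ∘ eta M =1 lscale ((-1) ^ (n * p)) (eta M' ∘ tensM idl psi)].

Definition E_omega_ob : dgaData k :=
  {| dga_car := fam; dga_zero := fun M => lzero _ _;
     dga_add := fun eta theta M => ladd (eta M) (theta M);
     dga_scale := fun a eta M => lscale a (eta M);
     dga_deg := is_end; dga_one := fun M => idl;
     dga_mul := fun eta theta M => eta M ∘ theta M;
     dga_dif := fun eta M => dHom (eta M) |}.

(* Z_0 End^(x)(C (x) omega) *)
Definition is_tens_end (eta : fam) : Prop :=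
  [/\ is_end 0 eta,
      forall M, dHom (eta M) =1 lzero _ _,
      eta (unit_mod H) =1 idl &
      forall M M' : dgMod H, eta (tens_mod M M') =1 tens_comod (eta M) (eta M')].

Definition P_omega_ob : grpData :=
  {| grp_car := fam; grp_mem := is_tens_end; grp_one := fun M => idl;
     grp_mul := fun eta theta M => eta M ∘ theta M |}.

End Comodule.

Definition E_omega_map (C C' : ccdgCoalg k) (f : {linear C -> C'}) (eta : fam C') : fam C :=
  fun M => tensM idl (qcheck (eta M)) ∘ tensM idl (tensM f idl) ∘ coact C M.

Definition E_omega : presheafData k (dgA k) :=
  @PresheafData k (dgA k) E_omega_ob E_omega_map.

Definition P_omega : presheafData k Grp :=
  @PresheafData k Grp P_omega_ob E_omega_map.

End EndOmega.

(* Main.v *)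
Require Import Defs.
From mathcomp Require Import all_boot all_order all_algebra.
From mathcomp Require Import boolp.
Import GRing.Theory.
(* [seq] also exports an [iota]. *)
Import Defs.
Set Implicit Arguments.
Unset Strict Implicit.
Unset Printing Implicit Defensive.
Local Open Scope ring_scope.

(* A degree n map a : C -> Omega acts on every C (x) M by
     c (x) v |-> c' (x) a(c'') v  (up to sign),
   the comodule extension of c (x) v |-> a(c) v. Conversely a natural comodule
   endomorphism eta is determined by a(c) = q(eta_Omega)(c (x) 1): naturality
   with respect to right multiplication x |-> +- x v, a morphism Omega -> M of
   the degree of v, gives q(eta_M)(c (x) v) = a(c) v. Under this bijection
   composition becomes convolution, and compatibility of eta with k, with the
   tensor product and with the differential says that a is compatible with the
   counit, the coproduct and the differential. Hence all the structure of E_omega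
   and P_omega is transported from E_Omega and P_Omega. *)

(** Elements of these algebras are sums of homogeneous maps, so no single degree is at hand for the
    Koszul signs. The operator [conjs] inserts the right sign on each homogeneous component; with it
    the correspondence a |-> eta is defined, linear, multiplicative and compatible with
    differentials for every linear map a. The regular module is free on 1, which is why the
    component eta_Omega carries all the information: this is a Yoneda argument, with comodule
    linearity removing the extra factor C. The antipode axioms give only two convolution identities,
    so the inverse of a coalgebra morphism has to be shown to be one. For the coproduct this uses
    uniqueness of inverses with values in Omega (x) Omega; for this reason convolution is developed
    for a general target algebra. Cocommutativity of C makes the convolution of two coalgebra
    morphisms a coalgebra morphism. *)

(** * Koszul sign calculus for linear maps of mixed degree *)

Section Koszul.
Variable k : fieldType.
Implicit Types (V W X Y Z : complexType k).

Lemma laddE V W (f g : {linear V -> W}) v : ladd f g v = f v + g v.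
Proof. by []. Qed.

Lemma sgnV (m : int) : (-1) ^ (- m) = (-1) ^ m :> k.
Proof. by rewrite -[LHS]mulr1 -[X in _ * X](sgnsq k m) mulrA -sgnN1 addNr expr0z mul1r. Qed.

Lemma sgn_sgn V m n (v : V) : sgn V m (sgn V n v) = sgn V (m + n) v.
Proof.
rewrite -lcompE; move: v; apply: ext_deg => i v vi.
by rewrite lcompE !(sgn_deg _ vi) linZ (sgn_deg _ vi) scalerA mulrDl sgnN1 mulrC.
Qed.

Lemma sgn0 V (v : V) : sgn V 0 v = v.
Proof.
rewrite -[RHS]/(idl v); move: v; apply: ext_deg => i v vi.
by rewrite (sgn_deg _ vi) mul0r scale1r.
Qed.

Lemma sgnK V m : involutive (sgn V m).
Proof.
move=> v; rewrite -[sgn V m (sgn V m v)]lcompE -[RHS]/(idl v).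
move: v; apply: ext_deg => i v vi.
by rewrite lcompE (sgn_deg _ vi) linZ (sgn_deg _ vi) scalerA sgnsq scale1r.
Qed.

Lemma sgn_homog V W m n (f : {linear V -> W}) v : homog n f ->
  sgn W m (f v) = (-1) ^ (m * n) *: f (sgn V m v).
Proof. by move=> fn; rewrite -(conjs_homog _ _ fn) /conjs !lcompE sgnK. Qed.

Lemma sgn_dif V m (v : V) : sgn V m (dif v) = (-1) ^ m *: dif (sgn V m v).
Proof. by rewrite (@sgn_homog _ _ _ (-1)) ?mulrN1 ?sgnV // => n w; rewrite dif_pr. Qed.

Lemma homog_sgn V m : homog 0 (sgn V m).
Proof. by apply: homogP => i v vi; rewrite (sgn_deg _ vi) addr0; exact: ofdegZ. Qed.

Lemma conjs_conjs V W m n (f : {linear V -> W}) : conjs m (conjs n f) = conjs (m + n) f.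
Proof. by apply: lin_eq => v; rewrite /conjs !lcompE !sgn_sgn (addrC n). Qed.

Lemma conjs0 V W (f : {linear V -> W}) : conjs 0 f = f.
Proof. by apply: lin_eq => v; rewrite /conjs !lcompE !sgn0. Qed.

Lemma conjs_comp X V W m (g : {linear V -> W}) (f : {linear X -> V}) :
  conjs m (g ∘ f) = conjs m g ∘ conjs m f.
Proof. by apply: lin_eq => v; rewrite /conjs !lcompE sgnK. Qed.

Lemma conjs_homog0 V W m (f : {linear V -> W}) : homog 0 f -> conjs m f = f.
Proof. by move=> f0; apply: lin_eq => v; rewrite (conjs_homog _ _ f0) mulr0 scale1r. Qed.

Lemma conjs_add V W m (f g : {linear V -> W}) :
  conjs m (ladd f g) = ladd (conjs m f) (conjs m g).
Proof. by apply: lin_eq => v; apply: (linD (sgn W m)). Qed.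

Lemma conjs_scale V W m a (f : {linear V -> W}) :
  conjs m (lscale a f) = lscale a (conjs m f).
Proof. by apply: lin_eq => v; apply: (linZ (sgn W m)). Qed.

Lemma lcompA V W X Y (h : {linear X -> Y}) (g : {linear W -> X}) (f : {linear V -> W}) :
  h ∘ (g ∘ f) = h ∘ g ∘ f.
Proof. exact: lin_eq. Qed.

Lemma comp_idl V W (f : {linear V -> W}) : f ∘ idl = f.
Proof. exact: lin_eq. Qed.

Lemma idl_comp V W (f : {linear V -> W}) : idl ∘ f = f.
Proof. exact: lin_eq. Qed.

Lemma homog0_comp X V W (g : {linear V -> W}) (f : {linear X -> V}) :
  homog 0 g -> homog 0 f -> homog 0 (g ∘ f).
Proof. by move=> g0 f0; rewrite -[0]addr0; exact: homog_comp. Qed.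

Lemma tens_ext_hom V W (U : lmodType k) (f g : {linear V ⊗ W -> U}) :
  (forall i j v w, ofdeg i v -> ofdeg j w -> f (v ⊗ₜ w) = g (v ⊗ₜ w)) -> f = g.
Proof. by move=> H; apply/lin_eq/tens_car_ext_deg. Qed.

(** [conjs i g] is (-1)^(i |g|) g on each homogeneous component of g, so this form of the Koszul
    rule asks for no degree of g; only v has to be homogeneous. *)
Lemma tensM_conjs V W X Y (f : {linear V -> X}) (g : {linear W -> Y}) i v w :
  ofdeg i v -> tensM f g (v ⊗ₜ w) = f v ⊗ₜ conjs i g w.
Proof.
move=> vi; rewrite /tensM tlift_pure (gext_deg _ vi) // => j a x y.
by rewrite linearP; exact: (pure_bilin X Y).1.
Qed.

Lemma homog_tensM0 V W X Y (f : {linear V -> X}) (g : {linear W -> Y}) :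
  homog 0 f -> homog 0 g -> homog 0 (tensM f g).
Proof. by move=> f0 g0; rewrite -[0]addr0; exact: homog_tensM. Qed.

Lemma tensM_id V W : tensM idl idl = idl :> {linear V ⊗ W -> V ⊗ W}.
Proof. by apply/lin_eq/tens_ext => v w; rewrite tensM0 //; exact: homog_id. Qed.

Lemma tensM_compl V W X Y Z (f : {linear X -> Y}) (f' : {linear V -> X})
    (g : {linear W -> Z}) :
  tensM f idl ∘ tensM f' g = tensM (f ∘ f') g.
Proof.
apply: tens_ext_hom => i j v w vi _.
by rewrite lcompE !(tensM_conjs _ _ _ vi) tensM0 //; exact: homog_id.
Qed.

Lemma tensM_compr V W X Y Z (f : {linear V -> X}) (g : {linear Y -> Z})
    (g' : {linear W -> Y}) :
  tensM f g ∘ tensM idl g' = tensM f (g ∘ g').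
Proof.
apply: tens_ext_hom => i j v w vi _.
by rewrite lcompE !(tensM_conjs _ _ _ vi) conjs_comp.
Qed.

(** The general exchange law carries the sign (-1)^(|g| |f'|). It disappears if f' has degree 0, as
    here, or if g has degree 0, as in [tensM_comp0]. *)
Lemma tensM_comp V W X Y V' W' (f : {linear X -> V'}) (g : {linear Y -> W'})
    (f' : {linear V -> X}) (g' : {linear W -> Y}) :
  homog 0 f' -> tensM f g ∘ tensM f' g' = tensM (f ∘ f') (g ∘ g').
Proof.
move=> f0; apply: tens_ext_hom => i j v w vi _; rewrite lcompE !(tensM_conjs _ _ _ vi).
have f'v : ofdeg i (f' v) by rewrite -[i]addr0; exact: homog_ofdeg.
by rewrite (tensM_conjs _ _ _ f'v) conjs_comp.
Qed.

Lemma tensM_comp0 V W X Y V' W' (f : {linear X -> V'}) (g : {linear Y -> W'})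
    (f' : {linear V -> X}) (g' : {linear W -> Y}) :
  homog 0 g -> tensM f g ∘ tensM f' g' = tensM (f ∘ f') (g ∘ g').
Proof.
move=> g0; apply: tens_ext_hom => i j v w vi _; rewrite lcompE !(tensM_conjs _ _ _ vi).
by rewrite tensM0 // conjs_comp (conjs_homog0 _ g0).
Qed.

Lemma conjs_tensM V W X Y m (f : {linear V -> X}) (g : {linear W -> Y}) :
  conjs m (tensM f g) = tensM (conjs m f) (conjs m g).
Proof.
have E (A B : complexType k) : sgn (A ⊗ B) m = tensM (sgn A m) (sgn B m).
  apply: tens_ext_hom => i j v w vi wj; rewrite tensM0; last exact: homog_sgn.
  rewrite (sgn_deg _ (ofdeg_pure vi wj)) (sgn_deg _ vi) (sgn_deg _ wj).
  by rewrite pureZl pureZr scalerA mulrDr sgnN1.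
rewrite /conjs !E tensM_comp0; last exact: homog_sgn.
by rewrite tensM_comp //; exact: homog_sgn.
Qed.

Lemma assoc_nat V W X V' W' X' (f : {linear V -> V'}) (g : {linear W -> W'})
    (h : {linear X -> X'}) :
  assoc V' W' X' ∘ tensM (tensM f g) h = tensM f (tensM g h) ∘ assoc V W X.
Proof.
apply: lin_eq.
apply: (spans_pure (spans_pure (@spans_hom k V) (@spans_hom k W)) (@spans_hom k X)).
move=> _ [_ [x [[v [w [[i vi] [j wj] ->]]] _ ->]]].
rewrite !lcompE (tensM_conjs _ _ _ (ofdeg_pure vi wj)) (tensM_conjs _ _ _ vi).
rewrite !assoc_pure (tensM_conjs _ _ _ vi) conjs_tensM (tensM_conjs _ _ _ wj).
by rewrite conjs_conjs addrC.
Qed.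

Lemma mid_nat V W X Y V' W' X' Y' (f : {linear V -> V'}) (g : {linear W -> W'})
    (h : {linear X -> X'}) (l : {linear Y -> Y'}) :
  homog 0 f -> homog 0 g -> homog 0 h -> homog 0 l ->
  mid V' W' X' Y' ∘ tensM (tensM f g) (tensM h l) =
  tensM (tensM f h) (tensM g l) ∘ mid V W X Y.
Proof.
move=> f0 g0 h0 l0; apply: lin_eq.
apply: (spans_pure (spans_pure (@spans_hom k V) (@spans_hom k W))
  (spans_pure (@spans_hom k X) (@spans_hom k Y))).
move=> _ [_ [_ [[v [w [_ [j wj] ->]]] [x [y [[l' xl] _ ->]]] ->]]].
have gw : ofdeg j (g w) by rewrite -[j]addr0; exact: homog_ofdeg.
have hx : ofdeg l' (h x) by rewrite -[l']addr0; exact: homog_ofdeg.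
rewrite lcompE [RHS]lcompE tensM0; last exact: homog_tensM0.
rewrite !(tensM0 _ _ _ g0, tensM0 _ _ _ l0) (mid_deg _ _ gw hx) (mid_deg _ _ wj xl).
rewrite (linZ (tensM _ _)) tensM0; last exact: homog_tensM0.
by rewrite !(tensM0 _ _ _ h0, tensM0 _ _ _ l0).
Qed.

Lemma dHomE V W (f : {linear V -> W}) v : dHom f v = dif (f v) - conjs 1 f (dif v).
Proof. by []. Qed.

Lemma dHom_comp X V W (g : {linear V -> W}) (f : {linear X -> V}) :
  dHom (g ∘ f) = ladd (dHom g ∘ f) (conjs 1 g ∘ dHom f).
Proof.
apply: lin_eq => v; rewrite dHomE conjs_comp.
rewrite -[RHS]/(dHom g (f v) + conjs 1 g (dHom f v)) !dHomE linearB.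
by rewrite addrA subrK.
Qed.

Lemma dHom_chain V W (f : {linear V -> W}) : chain_map f -> dHom f = lzero V W.
Proof.
move=> [f0 fd]; apply: lin_eq => v; rewrite (dHom_homog _ f0) scale1r.
by have:= fd v; rewrite !lcompE => ->; rewrite subrr.
Qed.

Lemma chain_dHom V W (f : {linear V -> W}) : homog 0 f -> dHom f = lzero V W -> chain_map f.
Proof.
move=> f0 fd; split=> // v; apply/eqP; rewrite -subr_eq0 !lcompE; apply/eqP.
by rewrite -[f (dif v)]scale1r -[X in X *: _](expr0z (-1)) -(dHom_homog _ f0) fd.
Qed.

Lemma dHom_compl X V W (g : {linear V -> W}) (f : {linear X -> V}) :
  chain_map g -> dHom (g ∘ f) = g ∘ dHom f.
Proof.
move=> gc; rewrite dHom_comp dHom_chain // conjs_homog0 //; last exact: gc.1.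
by apply: lin_eq => v; rewrite laddE -[(lzero V W ∘ f) v]/0 add0r.
Qed.

Lemma dHom_compr X V W (g : {linear V -> W}) (f : {linear X -> V}) :
  chain_map f -> dHom (g ∘ f) = dHom g ∘ f.
Proof.
move=> fc; rewrite dHom_comp (dHom_chain fc).
by apply: lin_eq => v; rewrite -[LHS]/(dHom g (f v) + conjs 1 g 0) linear0 addr0.
Qed.

Lemma dif_pure_sgn V W (v : V) (w : W) :
  dif (v ⊗ₜ w) = dif v ⊗ₜ w + sgn V 1 v ⊗ₜ dif w.
Proof. exact: tlift0_pure. Qed.

Lemma pureBl V W (v v' : V) (w : W) : (v - v') ⊗ₜ w = v ⊗ₜ w - v' ⊗ₜ w.
Proof. exact: (linearB (purel V w)). Qed.

Lemma pureBr V W (v : V) (w w' : W) : v ⊗ₜ (w - w') = v ⊗ₜ w - v ⊗ₜ w'.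
Proof. exact: (linearB (purer W v)). Qed.

(** The differential lowers the degree by one, and (-1)^(m (n - 1)) = (-1)^m (-1)^(m n). *)
Lemma conjs_dHom V W m (f : {linear V -> W}) v :
  conjs m (dHom f) v = (-1) ^ m *: dHom (conjs m f) v.
Proof.
rewrite -[LHS]/(sgn W m (dif (f (sgn V m v)) - sgn W 1 (f (sgn V 1 (dif (sgn V m v)))))).
rewrite -[dHom _ _]/(dif (sgn W m (f (sgn V m v))) -
  sgn W 1 (sgn W m (f (sgn V m (sgn V 1 (dif v)))))).
rewrite (linearB (sgn W m)) scalerBr; congr (_ - _); first exact: sgn_dif.
rewrite !(@sgn_sgn W) (addrC 1 m) (@sgn_sgn V m 1) addrC -(@sgn_sgn V 1 m) (sgn_dif m v) !linZ.
by rewrite scalerA sgnsq scale1r.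
Qed.

Lemma sgn_conjs V W m (f : {linear V -> W}) i v : ofdeg i v ->
  (-1) ^ (m * i) *: conjs m f v = sgn W m (f v).
Proof.
move=> vi; rewrite -[conjs m f v]/(sgn W m (f (sgn V m v))) (sgn_deg m vi).
by rewrite (linZ f) (linZ (sgn W m)) scalerA sgnsq scale1r.
Qed.

(** The Leibniz rule, with [conjs 1 f] in place of (-1)^|f| f so that f may be of mixed degree. *)
Lemma dHom_tensM V W X Y (f : {linear V -> X}) (g : {linear W -> Y}) :
  dHom (tensM f g) = ladd (tensM (dHom f) g) (tensM (conjs 1 f) (dHom g)).
Proof.
apply: tens_ext_hom => i j v w vi wj; rewrite laddE !(tensM_conjs _ _ _ vi).
rewrite conjs_dHom !dHomE conjs_tensM (tensM_conjs f g w vi).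
rewrite dif_pure_sgn (dif_pure _ vi) (linD (tensM _ _)) (linZ (tensM _ _)).
rewrite (tensM_conjs _ _ _ (dif_ofdeg vi)) (tensM_conjs _ _ _ vi) !conjs_conjs subrK.
rewrite -[sgn X 1 (f v)](sgn_conjs 1 f vi) mul1r.
rewrite pureBl pureZr pureZl pureBr scalerBr opprD (addrC 1 i).
by rewrite addrACA.
Qed.
End Koszul.

(** * Cofree comodules and coextension of maps *)

Section Comodules.
Variables (k : fieldType) (C : ccdgCoalg k).
Implicit Types (V W X Y A : complexType k).

(** Lets an equation for a composite of two maps be used inside a longer composition nested to the
    right. *)
Lemma lcomp_reassoc V W X Y (h : {linear X -> Y}) (g : {linear W -> X})
    (e : {linear W -> Y}) : h ∘ g = e ->
  forall f : {linear V -> W}, h ∘ (g ∘ f) = e ∘ f.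
Proof. by move=> <- f; rewrite lcompA. Qed.

Lemma coactE V : coact C V = assoc C C V ∘ tensM (comul C) idl.
Proof. by []. Qed.

Lemma qcheckE V W (phi : {linear C ⊗ V -> C ⊗ W}) :
  qcheck phi = iota W ∘ tensM (counit C) idl ∘ phi.
Proof. by []. Qed.

Local Opaque mid assoc associ tensM iota tau coact qcheck.

Lemma comulA_lin : assoc C C C ∘ (tensM (comul C) idl ∘ comul C) =
  tensM idl (comul C) ∘ comul C.
Proof. by apply: lin_eq => c; have := @comulA _ C c; rewrite !lcompE. Qed.

Lemma iota_inj V : injective (iota V).
Proof.
suff E : purer V (1 : ground k) ∘ iota V =1 idl.
  by move=> s t st; rewrite -[s]E -[t]E lcompE st.
apply: (spans_pure (@spans_ground k) (@spans_hom k V)) => _ [_ [v [-> _ ->]]].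
by rewrite lcompE iota_pure scale1r.
Qed.

Lemma counitlE c : tensM (counit C) idl (comul C c) = (1 : ground k) ⊗ₜ c.
Proof.
apply: iota_inj; rewrite iota_pure scale1r.
exact: (@counitl _ C c).
Qed.

Lemma counitrE c : tensM idl (counit C) (comul C c) = c ⊗ₜ (1 : ground k).
Proof.
have E t : t = iota C (tau C (ground k) t) ⊗ₜ (1 : ground k).
  suff : idl =1 purel C (1 : ground k) ∘ (iota C ∘ tau C (ground k)) by exact.
  apply: (spans_pure (@spans_hom k C) (@spans_ground k)) => _ [x [_ [[i xi] -> ->]]].
  rewrite !lcompE (tau_deg xi (ofdeg0_ground _)) mulr0 scale1r iota_pure scale1r.
  by [].
by rewrite [LHS]E; have := @counitr _ C c; rewrite !lcompE => ->.
Qed.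

Lemma iota_nat V W (f : {linear V -> W}) : iota W ∘ tensM idl f = f ∘ iota V.
Proof.
apply/lin_eq/(spans_pure (@spans_ground k) (@spans_hom k V)) => _ [_ [v [-> _ ->]]].
by rewrite !lcompE (tensM_conjs _ _ _ (ofdeg0_ground _)) conjs0 !iota_pure !scale1r.
Qed.

Lemma coact_pure V c v : coact C V (c ⊗ₜ v) = assoc C C V (comul C c ⊗ₜ v).
Proof. by rewrite coactE lcompE tensM0 //; exact: homog_id. Qed.

Lemma chain_coact V : chain_map (coact C V).
Proof.
rewrite coactE; apply: chain_comp; first exact: chain_assoc.
by apply: chain_tensM; [exact: comul_chain | exact: chain_id].
Qed.

Lemma coact_nat V W (f : {linear V -> W}) :
  coact C W ∘ tensM idl f = tensM idl (tensM idl f) ∘ coact C V.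
Proof.
rewrite !coactE lcompA -assoc_nat -!lcompA tensM_comp; last exact: homog_id.
rewrite tensM_comp; last exact: (comul_chain C).1.
by rewrite tensM_id !comp_idl !idl_comp.
Qed.

Lemma pentagon V W X Y :
  assoc V W (X ⊗ Y) ∘ assoc (V ⊗ W) X Y =
  tensM idl (assoc W X Y) ∘ (assoc V (W ⊗ X) Y ∘ tensM (assoc V W X) idl).
Proof.
apply/lin_eq.
apply: (spans_pure (spans_pure (spans_pure (@spans_hom k V) (@spans_hom k W))
  (@spans_hom k X)) (@spans_hom k Y)).
move=> _ [_ [y [[_ [x [[v [w [_ _ ->]]] _ ->]]] _ ->]]].
rewrite !lcompE (tensM0 _ _ _ (@homog_id k Y)) !assoc_pure.
by rewrite (tensM0 _ _ _ (chain_assoc _ _ _).1) !assoc_pure.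
Qed.

Lemma coact_coact V : coact C (C ⊗ V) ∘ coact C V = tensM idl (coact C V) ∘ coact C V.
Proof.
have D0 := (comul_chain C).1.
have E : tensM (comul C) (@idl k (C ⊗ V)) ∘ assoc C C V =
    assoc (C ⊗ C) C V ∘ tensM (tensM (comul C) idl) idl.
  by rewrite assoc_nat tensM_id.
rewrite !coactE -tensM_compr -!lcompA (lcomp_reassoc E) -!lcompA.
rewrite tensM_comp; last exact: D0.
rewrite (lcomp_reassoc (pentagon _ _ _ _)) -!lcompA comp_idl tensM_compl comulA_lin.
congr (_ ∘ _); rewrite (lcomp_reassoc (esym (assoc_nat _ _ _))) -lcompA; congr (_ ∘ _).
by rewrite tensM_comp // comp_idl.
Qed.

(** The coextension of f: the unique comodule map C (x) V -> C (x) W with projection f. This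
    universal property is [coliftK], [colift_qcheck] and [colift_comod]. *)
Definition colift V W (f : {linear C ⊗ V -> W}) : {linear C ⊗ V -> C ⊗ W} :=
  tensM idl f ∘ coact C V.

Lemma counit_coact V : iota (C ⊗ V) ∘ tensM (counit C) idl ∘ coact C V = idl.
Proof.
apply/lin_eq/tens_ext => c v; rewrite 2!lcompE coact_pure.
rewrite -[tensM (counit C) idl _]lcompE -tensM_id -assoc_nat lcompE.
rewrite (tensM0 _ _ _ (@homog_id k V)) counitlE.
by rewrite assoc_pure iota_pure scale1r tensM_id.
Qed.

Lemma coact_counit V :
  tensM idl (iota V ∘ tensM (counit C) idl) ∘ coact C V = idl.
Proof.
apply/lin_eq/tens_ext => c v; rewrite -tensM_compr 2!lcompE coact_pure.
rewrite -[tensM idl (tensM _ _) _]lcompE -assoc_nat lcompE.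
rewrite (tensM0 _ _ _ (@homog_id k V)) counitrE assoc_pure.
by rewrite (tensM0 _ _ _ (chain_iota V).1) iota_pure scale1r.
Qed.

Lemma coliftK V W (f : {linear C ⊗ V -> W}) : qcheck (colift f) = f.
Proof.
rewrite qcheckE /colift -!lcompA (lcomp_reassoc (tensM_comp _ _ _ (@homog_id k C))).
rewrite !comp_idl !idl_comp -[f in LHS]comp_idl -{1}[counit C]idl_comp.
rewrite -(tensM_comp _ _ _ (counit_chain C).1) -lcompA.
by rewrite (lcomp_reassoc (iota_nat _)) -lcompA [X in f ∘ X]lcompA counit_coact comp_idl.
Qed.

(** Comodule linearity turns the coaction followed by phi into phi followed by the coaction, which
    the right counit law collapses. *)
Lemma colift_qcheck V W (phi : {linear C ⊗ V -> C ⊗ W}) :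
  is_comod_map phi -> colift (qcheck phi) = phi.
Proof.
move=> /lin_eq E; rewrite /colift qcheckE -tensM_compr -lcompA -E lcompA.
by rewrite coact_counit idl_comp.
Qed.

Lemma colift_comod V W (f : {linear C ⊗ V -> W}) : is_comod_map (colift f).
Proof.
suff E : coact C W ∘ colift f = tensM idl (colift f) ∘ coact C V by move=> t; rewrite E.
by rewrite /colift lcompA coact_nat -lcompA coact_coact lcompA tensM_compr.
Qed.

Lemma homog_colift V W n (f : {linear C ⊗ V -> W}) : homog n f -> homog n (colift f).
Proof.
move=> fn; rewrite -[n]add0r; apply: homog_comp; last exact: (chain_coact V).1.
by rewrite -[n]add0r; apply: homog_tensM => //; exact: homog_id.
Qed.

Lemma dHom_colift V W (f : {linear C ⊗ V -> W}) : dHom (colift f) = colift (dHom f).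
Proof.
rewrite /colift (dHom_compr _ (chain_coact V)) dHom_tensM (dHom_chain (@chain_id k C)).
apply: lin_eq => t; rewrite !lcompE laddE (conjs_homog0 _ (@homog_id k C)).
suff -> : tensM (lzero C C) f = lzero _ _ by rewrite add0r.
apply: tens_ext_hom => i j v w vi _; rewrite (tensM_conjs _ _ _ vi).
exact: (linear0 (purel _ _)).
Qed.

(** Composition in the co-Kleisli category of the comonad C (x) -: composites of comodule maps can
    be computed on their projections. *)
Lemma colift_comp V W X (f : {linear C ⊗ W -> X}) (g : {linear C ⊗ V -> W}) :
  colift f ∘ colift g = colift (f ∘ colift g).
Proof.
rewrite -[RHS]/(tensM idl (f ∘ colift g) ∘ coact C V) -tensM_compr -lcompA.
by have /lin_eq <- := colift_comod g; rewrite lcompA.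
Qed.

End Comodules.

(** * Convolution with values in a general algebra *)

Section Convolution.
Variables (k : fieldType) (C : ccdgCoalg k).
Variables (A : complexType k) (m : {linear A ⊗ A -> A}) (u : {linear ground k -> A}).
Implicit Types a b c : {linear C -> A}.

(** The target is only a complex with a product; the algebra axioms are hypotheses of the lemmas
    that use them. The cases used are Omega, where this is [conv], and Omega (x) Omega. *)
Definition convA a b : {linear C -> A} := m ∘ tensM a b ∘ comul C.

Lemma convA_assoc a b c : homog 0 m ->
  m ∘ tensM m idl = m ∘ tensM idl m ∘ assoc A A A ->
  convA a (convA b c) = convA (convA a b) c.
Proof.
move=> m0 mA; have D0 := (comul_chain C).1.
have El : tensM a (convA b c) = tensM idl m ∘ (tensM a (tensM b c) ∘ tensM idl (comul C)).
  by rewrite tensM_compr tensM_comp0 // idl_comp lcompA.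
have Er : tensM (convA a b) c = tensM m idl ∘ (tensM (tensM a b) c ∘ tensM (comul C) idl).
  by rewrite tensM_comp // tensM_compl lcompA comp_idl.
rewrite /convA -[m ∘ tensM a b ∘ comul C]/(convA a b) -[m ∘ tensM b c ∘ comul C]/(convA b c).
rewrite El Er -!lcompA -comulA_lin.
by rewrite (lcomp_reassoc mA) -!lcompA (lcomp_reassoc (assoc_nat _ _ _)) -!lcompA.
Qed.

Lemma convA_unitl a : (forall x, m (u 1 ⊗ₜ x) = x) -> convA (u ∘ counit C) a = a.
Proof.
move=> m1; apply: lin_eq => c.
rewrite -[LHS]/(m (tensM (u ∘ counit C) a (comul C c))).
have -> : tensM (u ∘ counit C) a = tensM u idl ∘ (tensM idl a ∘ tensM (counit C) idl).
  rewrite tensM_comp; last exact: (counit_chain C).1.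
  by rewrite tensM_compl comp_idl idl_comp.
rewrite 2!lcompE counitlE (tensM_conjs _ _ _ (ofdeg0_ground _)) conjs0.
by rewrite (tensM0 _ _ _ (@homog_id k A)) m1.
Qed.

Lemma convA_unitr a : homog 0 u -> (forall x, m (x ⊗ₜ u 1) = x) ->
  convA a (u ∘ counit C) = a.
Proof.
move=> u0 m1; apply: lin_eq => c.
rewrite -[LHS]/(m (tensM a (u ∘ counit C) (comul C c))).
by rewrite -tensM_compr lcompE counitrE tensM0 // m1.
Qed.

Lemma dHom_convA a b : chain_map m ->
  dHom (convA a b) = ladd (convA (dHom a) b) (convA (conjs 1 a) (dHom b)).
Proof.
move=> mc; rewrite /convA (dHom_compr _ (comul_chain C)) dHom_compl // dHom_tensM.
apply: lin_eq => x; rewrite [RHS]laddE !lcompE laddE; exact: linD.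
Qed.

Lemma homog_convA p q a b : homog 0 m -> homog p a -> homog q b -> homog (p + q) (convA a b).
Proof.
move=> m0 ap bq; rewrite -[p + q]add0r.
apply: homog_comp; last exact: (comul_chain C).1.
by rewrite -[p + q]addr0; apply: homog_comp => //; exact: homog_tensM.
Qed.

End Convolution.

(** * Linear structure and differential of Hom complexes *)

Section LinearStructure.
Variable k : fieldType.
Implicit Types (V W X Y : complexType k).

Lemma tensM_linl V W X Y a (f f' : {linear V -> X}) (g : {linear W -> Y}) :
  tensM (ladd (lscale a f) f') g = ladd (lscale a (tensM f g)) (tensM f' g).
Proof.
apply: tens_ext_hom => i j v w vi _.
rewrite laddE lscaleE !(tensM_conjs _ _ _ vi) laddE lscaleE.
by rewrite pureDl pureZl.
Qed.

Lemma tensM_linr V W X Y a (f : {linear V -> X}) (g g' : {linear W -> Y}) :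
  tensM f (ladd (lscale a g) g') = ladd (lscale a (tensM f g)) (tensM f g').
Proof.
apply: tens_ext_hom => i j v w vi _.
rewrite laddE lscaleE !(tensM_conjs _ _ _ vi) conjs_add conjs_scale laddE lscaleE.
by rewrite pureDr pureZr.
Qed.

Lemma tensM_scalel V W X Y a (f : {linear V -> X}) (g : {linear W -> Y}) :
  tensM (lscale a f) g = lscale a (tensM f g).
Proof.
apply: tens_ext_hom => i j v w vi _.
by rewrite lscaleE !(tensM_conjs _ _ _ vi) lscaleE pureZl.
Qed.

Lemma tensM_scaler V W X Y a (f : {linear V -> X}) (g : {linear W -> Y}) :
  tensM f (lscale a g) = lscale a (tensM f g).
Proof.
apply: tens_ext_hom => i j v w vi _.
by rewrite lscaleE !(tensM_conjs _ _ _ vi) conjs_scale lscaleE pureZr.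
Qed.

Lemma lcomp_linl V W X a (f f' : {linear W -> X}) (g : {linear V -> W}) :
  ladd (lscale a f) f' ∘ g = ladd (lscale a (f ∘ g)) (f' ∘ g).
Proof. exact: lin_eq. Qed.

Lemma lcomp_linr V W X a (f : {linear W -> X}) (g g' : {linear V -> W}) :
  f ∘ ladd (lscale a g) g' = ladd (lscale a (f ∘ g)) (f ∘ g').
Proof. by apply: lin_eq => v; rewrite lcompE !laddE !lscaleE linD linZ. Qed.

Lemma dHom_lin V W a (f g : {linear V -> W}) :
  dHom (ladd (lscale a f) g) = ladd (lscale a (dHom f)) (dHom g).
Proof.
apply: lin_eq => v; rewrite laddE lscaleE !dHomE conjs_add conjs_scale.
rewrite !laddE !lscaleE linD linZ scalerBr opprD addrACA; congr (_ + _ + _).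
Qed.

Lemma dHom_dHom V W (f : {linear V -> W}) : dHom (dHom f) = lzero V W.
Proof.
apply: lin_eq => v; rewrite dHomE conjs_dHom !dHomE dif_dif.
rewrite linear0 subr0 linearB /= dif_dif expr1z scaleN1r opprK sub0r.
by rewrite addNr.
Qed.

Lemma ladd0f V W (f : {linear V -> W}) : ladd (lzero V W) f = f.
Proof. by apply: lin_eq => v; rewrite laddE add0r. Qed.

Lemma laddf0 V W (f : {linear V -> W}) : ladd f (lzero V W) = f.
Proof. by apply: lin_eq => v; rewrite laddE addr0. Qed.

Lemma lscale1f V W (f : {linear V -> W}) : lscale 1 f = f.
Proof. by apply: lin_eq => v; rewrite lscaleE scale1r. Qed.

Lemma laddNf V W (f : {linear V -> W}) : ladd (lscale (-1) f) f = lzero V W.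
Proof. by apply: lin_eq => v; rewrite laddE lscaleE scaleN1r addNr. Qed.

Lemma lsum_direct V W (s : seq int) (x : int -> {linear V -> W}) :
  uniq s -> (forall i, homog i (x i)) ->
  \big[@ladd k V W/lzero V W]_(i <- s) x i = lzero V W ->
  forall i, i \in s -> x i = lzero V W.
Proof.
move=> us xh x0 i si; apply: lin_eq; apply: ext_deg => j v vj.
have E : (\big[@ladd k V W/lzero V W]_(l <- s) x l) v = \sum_(l <- s) x l v.
  by elim: (s) => [|l r IH]; rewrite ?big_nil // !big_cons laddE IH.
(* On v of degree j the summand [x l v] lies in degree j + l, so projection to degree j + i isolates
   [x i v]. *)
have := congr1 (pr (j + i)) E; rewrite x0 linear0 linear_sum (bigD1_seq i) //= big1.
  by rewrite addr0 (ofdeg_pr0 _ (homog_ofdeg (xh i) vj)) eqxx => <-.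
move=> l li; rewrite (ofdeg_pr0 _ (homog_ofdeg (xh l) vj)).
by rewrite (inj_eq (addrI j)) eq_sym (negbTE li).
Qed.

Lemma homog_lzero V W n : homog n (lzero V W).
Proof. by move=> i v; rewrite linear0. Qed.

Lemma homog_ladd V W n (f g : {linear V -> W}) : homog n f -> homog n g -> homog n (ladd f g).
Proof. by move=> fn gn i v; rewrite !laddE fn gn linD. Qed.

Lemma homog_lscale V W n a (f : {linear V -> W}) : homog n f -> homog n (lscale a f).
Proof. by move=> fn i v; rewrite !lscaleE fn linZ. Qed.

Lemma homog_dHom V W n (f : {linear V -> W}) : homog n f -> homog (n - 1) (dHom f).
Proof.
move=> fn i v; rewrite !(dHom_homog _ fn) dif_pr !fn dif_pr linearB /=.
by rewrite [pr _ (_ *: _)]linZ (addrA i n (-1)) (addrAC i (-1) n).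
Qed.

End LinearStructure.

(** * The convolution dg-algebras E_Omega(C) *)

Section HopfAlgebra.
Variables (k : fieldType) (H : ccdgHopf k).
Local Notation u := (hunit H).
Local Notation m := (hmul H).

Lemma hmul1r x : m (x ⊗ₜ u 1) = x.
Proof. exact: (dga_mul1r (hopf_is_dga H) (total_complex x)). Qed.

Lemma hmul_assoc : m ∘ tensM m idl = m ∘ tensM idl m ∘ assoc H H H.
Proof.
apply: lin_eq.
apply: (spans_pure (spans_pure (@spans_hom k H) (@spans_hom k H)) (@spans_hom k H)).
move=> _ [_ [z [[x [y [_ _ ->]]] _ ->]]].
rewrite lcompE 2!lcompE assoc_pure (tensM0 _ _ _ (@homog_id k H)).
by rewrite (tensM0 _ _ _ (@hmul_homog k H)) hmulA.
Qed.

Lemma groundE (a : ground k) : a = (a : k) *: (1 : ground k).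
Proof. by rewrite /GRing.scale /= mulr1. Qed.

Lemma hunit_homog : homog 0 u.
Proof.
apply: homogP => i a /ofdeg_ground[-> | ->]; last by rewrite linear0 /ofdeg linear0.
by rewrite (groundE a) linZ; apply: ofdegZ; exact: hunit_deg.
Qed.

(** From 1 1 = 1 the Leibniz rule gives d 1 = d 1 + d 1, since 1 has degree 0. *)
Lemma dif_hunit a : dif (u a) = 0.
Proof.
have h1 := hunit_deg H.
rewrite (groundE a) linZ [X in dif X]/= linZ; apply/eqP; rewrite scaler_eq0; apply/orP; right.
have := (hmul_chain H).2 (u 1 ⊗ₜ u 1); rewrite !lcompE hmul1l.
rewrite (dif_pure _ h1) scale1r linD hmul1l hmul1r => /eqP.
by rewrite -subr_eq subrr eq_sym.
Qed.

Lemma hunit_chain : chain_map u.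
Proof.
split; first exact: hunit_homog.
by move=> a; rewrite !lcompE dif_hunit -[dif a]/0 linear0.
Qed.

Section Conv.
Variable C : ccdgCoalg k.
Implicit Types a b : {linear C -> H}.

Lemma convE a b : conv a b = convA m a b.
Proof. by []. Qed.

Lemma convA_linl s a a' b :
  convA m (ladd (lscale s a) a') b = ladd (lscale s (convA m a b)) (convA m a' b).
Proof. by rewrite /convA tensM_linl lcomp_linr lcomp_linl. Qed.

Lemma convA_linr s a b b' :
  convA m a (ladd (lscale s b) b') = ladd (lscale s (convA m a b)) (convA m a b').
Proof. by rewrite /convA tensM_linr lcomp_linr lcomp_linl. Qed.

Lemma conv0l b : conv (lzero C H) b = lzero C H.
Proof. by have := convA_linl (-1) (lzero C H) (lzero C H) b; rewrite !laddNf. Qed.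

Lemma conv0r a : conv a (lzero C H) = lzero C H.
Proof. by have := convA_linr (-1) a (lzero C H) (lzero C H); rewrite !laddNf. Qed.

Lemma conv_assoc a b c : conv a (conv b c) = conv (conv a b) c.
Proof. exact: convA_assoc (@hmul_homog k H) hmul_assoc. Qed.

Lemma conv_unitl a : conv (u ∘ counit C) a = a.
Proof. exact: (convA_unitl _ (@hmul1l _ H)). Qed.

Lemma conv_unitr a : conv a (u ∘ counit C) = a.
Proof. exact: (convA_unitr _ hunit_homog hmul1r). Qed.

Lemma E_Omega_is_dga : is_dga (E_Omega_ob H C).
Proof.
split=> /=.
- by move=> f g h; apply: lin_eq => x; rewrite !laddE addrA.
- by move=> f g; apply: lin_eq => x; rewrite !laddE addrC.
- exact: ladd0f.
- exact: laddNf.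
- by move=> a b f; apply: lin_eq => x; rewrite !lscaleE scalerA.
- by move=> f; apply: lin_eq => x; rewrite !lscaleE scale1r.
- by move=> a f g; apply: lin_eq => x; rewrite !(laddE, lscaleE) scalerDr.
- by move=> a b f; apply: lin_eq => x; rewrite !(laddE, lscaleE) scalerDl.
- exact: homog_lzero.
- exact: homog_ladd.
- exact: homog_lscale.
- exact: lsum_direct.
- by apply: homog0_comp; [exact: hunit_homog | exact: (counit_chain C).1].
- by move=> p q f g fp gq; exact: homog_convA (@hmul_homog k H) fp gq.
- by move=> s a a' b _ _ _; exact: convA_linl.
- by move=> s a b b' _ _ _; exact: convA_linr.
- by move=> a b c _ _ _; exact: conv_assoc.
- by move=> a _; exact: conv_unitl.
- by move=> a _; exact: conv_unitr.
- exact: homog_dHom.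
- by move=> s a b _ _; exact: dHom_lin.
- by move=> a _; exact: dHom_dHom.
- move=> n a b an _; rewrite convE dHom_convA; last exact: hmul_chain.
  have -> : conjs 1 a = lscale ((-1) ^ n) a.
    by apply: lin_eq => x; rewrite (conjs_homog _ _ an) mul1r lscaleE.
  congr (ladd _ _).
  apply: lin_eq => x; rewrite lscaleE /convA !lcompE; move: (comul C x) => t.
  rewrite -linZ; congr (m _).
  by rewrite tensM_scalel.
Qed.

End Conv.

Lemma conv_comp (C C' : ccdgCoalg k) (f : {linear C -> C'}) (a b : {linear C' -> H}) :
  is_coalg_mor f -> conv a b ∘ f = conv (a ∘ f) (b ∘ f).
Proof.
move=> [[f0 _] _ /lin_eq E]; rewrite /conv -!lcompA E.
by rewrite (lcomp_reassoc (tensM_comp _ _ _ f0)).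
Qed.

Lemma conv_one_comp (C C' : ccdgCoalg k) (f : {linear C -> C'}) :
  is_coalg_mor f -> u ∘ counit C' ∘ f = u ∘ counit C.
Proof. by move=> [_ /lin_eq E _]; rewrite -lcompA E. Qed.

Lemma E_Omega_presheaf : is_presheaf (E_Omega H).
Proof.
split=> /=.
- exact: E_Omega_is_dga.
- move=> C C' f fm; have [f0 fd] := coalg_mor_chain fm; split=> /=.
  + by move=> n a an; rewrite -[n]add0r; exact: homog_comp.
  + by move=> s a b _ _; exact: lcomp_linl.
  + exact: conv_one_comp.
  + by move=> a b _ _; exact: conv_comp.
  + by move=> a _; rewrite dHom_compr.
- by move=> C a _; exact: comp_idl.
- by move=> C C' C'' g f a _ _ _; exact: lcompA.
Qed.

End HopfAlgebra.

(** * Natural families of comodule maps and their coefficients in Omega *)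

Section Reconstruction.
Variables (k : fieldType) (H : ccdgHopf k).
Local Notation u := (hunit H).
Local Notation m := (hmul H).

Lemma act_assoc (M : dgMod H) x y (v : M) :
  act M (m (x ⊗ₜ y) ⊗ₜ v) = act M (x ⊗ₜ act M (y ⊗ₜ v)).
Proof.
have := @actA k H M ((x ⊗ₜ y) ⊗ₜ v); rewrite lcompE 2!lcompE assoc_pure.
by rewrite (tensM0 _ _ _ (@homog_id k M)) (tensM0 _ _ _ (act_chain M).1).
Qed.

Lemma act_homog (M : dgMod H) : homog 0 (act M).
Proof. exact: (act_chain M).1. Qed.

Fact reg_actA : m ∘ tensM m idl =1 m ∘ tensM idl m ∘ assoc H H H.
Proof. by move=> t; rewrite hmul_assoc. Qed.

Definition reg_mod : dgMod H := DgMod (hmul_chain H) reg_actA (@hmul1l k H).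

Section Fixed.
Variable C : ccdgCoalg k.
Implicit Types (a b : {linear C -> H}) (eta : fam H C) (M : dgMod H).

Definition coeff_act a M : {linear C ⊗ M -> M} := act M ∘ tensM a idl.

Definition endo_of a : fam H C := fun M => colift (coeff_act a M).

Definition elem_of eta : {linear C -> H} := qcheck (eta reg_mod) ∘ @purel k C reg_mod (u 1).

Lemma coeff_act_pure a M c (v : M) : coeff_act a M (c ⊗ₜ v) = act M (a c ⊗ₜ v).
Proof. by rewrite /coeff_act lcompE tensM0 //; exact: homog_id. Qed.

Lemma qcheck_endo_of a M : qcheck (endo_of a M) = coeff_act a M.
Proof. exact: coliftK. Qed.

Lemma endo_ofK : cancel endo_of elem_of.
Proof.
move=> a; apply: lin_eq => c; rewrite /elem_of qcheck_endo_of.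
rewrite -[LHS]/(coeff_act a reg_mod (c ⊗ₜ u 1)) coeff_act_pure; exact: hmul1r.
Qed.

(** By [colift_comp] only projections have to be compared: associativity of the action splits a(c')
    b(c'') into b acting first and a second, in the order of composition. *)
Lemma endo_of_conv a b M : endo_of (conv a b) M = endo_of a M ∘ endo_of b M.
Proof.
rewrite /endo_of colift_comp; congr colift.
have actl : act M ∘ tensM m idl = act M ∘ (tensM idl (act M) ∘ assoc H H M).
  by rewrite lcompA; apply: lin_eq; exact: actA.
have -> : coeff_act (conv a b) M =
    act M ∘ tensM m idl ∘ (tensM (tensM a b) idl ∘ tensM (comul C) idl).
  by rewrite /coeff_act -lcompA 2!tensM_compl lcompA.
rewrite actl -2!lcompA (lcomp_reassoc (assoc_nat _ _ _)) -lcompA -coactE.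
rewrite -[colift _]/(tensM idl (act M ∘ tensM b idl) ∘ coact C M).
rewrite -[coeff_act a M]/(act M ∘ tensM a idl) -lcompA [tensM a idl ∘ _]lcompA.
by rewrite tensM_compr idl_comp (lcomp_reassoc (tensM_comp0 _ _ _ (@act_homog M))) idl_comp.
Qed.

Lemma endo_of_one M : endo_of (u ∘ counit C) M = idl.
Proof.
rewrite -[RHS](@colift_qcheck k C M M idl); last first.
  by move=> t; rewrite comp_idl tensM_id idl_comp.
congr colift; apply/lin_eq/tens_ext => c v; rewrite coeff_act_pure.
rewrite -[RHS]/(iota M (tensM (counit C) idl (c ⊗ₜ v))).
rewrite (tensM0 _ _ _ (@homog_id k M)) iota_pure lcompE (groundE (counit C c)) linZ.
by rewrite pureZl linZ act1 [in RHS]/GRing.scale /= mulr1.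
Qed.

Lemma endo_of_lin s a b M :
  endo_of (ladd (lscale s a) b) M = ladd (lscale s (endo_of a M)) (endo_of b M).
Proof.
rewrite /endo_of /coeff_act tensM_linl lcomp_linr /colift.
by rewrite tensM_linr lcomp_linl.
Qed.

(** The coaction and the action are chain maps and identities have zero differential, so the Leibniz
    rule leaves only the term in [dHom a]. *)
Lemma endo_of_dHom a M : endo_of (dHom a) M = dHom (endo_of a M).
Proof.
rewrite /endo_of dHom_colift; congr colift.
rewrite /coeff_act dHom_compl; last exact: act_chain.
congr (_ ∘ _); rewrite dHom_tensM (dHom_chain (@chain_id k M)).
apply: lin_eq => t; rewrite laddE.
suff -> : tensM (conjs 1 a) (lzero M M) = lzero _ _ by rewrite addr0.
apply: tens_ext_hom => i j v w vi _; rewrite (tensM_conjs _ _ _ vi).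
rewrite (conjs_homog0 _ (@homog_lzero k M M 0)); exact: (linear0 (purer _ _)).
Qed.

Lemma coeff_act_nat n p a (M M' : dgMod H) (psi : {linear M -> M'}) :
  homog n a -> homog p psi -> is_mod_mor psi ->
  psi ∘ coeff_act a M = lscale ((-1) ^ (n * p)) (coeff_act a M' ∘ tensM idl psi).
Proof.
move=> an psip /lin_eq E; apply: tens_ext_hom => i j c v ci _.
rewrite lscaleE 2!lcompE coeff_act_pure -[psi _]lcompE E lcompE.
rewrite (tensM_deg _ _ psip (homog_ofdeg an ci)) (tensM_deg _ _ psip ci).
rewrite (linZ (act M')) (linZ (coeff_act a M')).
(* Moving psi past a(c), of degree i + n, costs p (i + n); moving it past c costs p i. The
   difference is n p. *)
by rewrite coeff_act_pure scalerA -sgnN1 mulrDr addrC mulrC.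
Qed.

Lemma endo_of_is_end n a : homog n a -> is_end n (endo_of a).
Proof.
move=> an; split=> [M|M|M M' p psi psip psiM].
- apply: homog_colift; rewrite -[n]addr0; apply: homog_comp; first exact: act_homog.
  by rewrite -[n]addr0; apply: homog_tensM => //; exact: homog_id.
- exact: colift_comod.
- move=> t.
  have -> : tensM idl psi ∘ endo_of a M = tensM idl (psi ∘ coeff_act a M) ∘ coact C M.
    by rewrite /endo_of /colift lcompA tensM_compr.
  rewrite (coeff_act_nat an psip psiM).
  have -> : endo_of a M' ∘ tensM idl psi =
      tensM idl (coeff_act a M' ∘ tensM idl psi) ∘ coact C M.
    by rewrite /endo_of /colift -lcompA coact_nat lcompA tensM_compr.
  rewrite lscaleE 2!lcompE; move: (coact C M t) => s.
  by rewrite tensM_scaler.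
Qed.

Lemma homog_qcheck n (V W : complexType k) (phi : {linear C ⊗ V -> C ⊗ W}) :
  homog n phi -> homog n (qcheck phi).
Proof.
move=> phin; rewrite -[n]addr0 qcheckE; apply: homog_comp => //.
apply: homog0_comp; first exact: (chain_iota W).1.
by apply: homog_tensM0; [exact: (counit_chain C).1 | exact: homog_id].
Qed.

Lemma elem_of_homog n eta : is_end n eta -> homog n (elem_of eta).
Proof.
move=> [eta_n _ _]; rewrite /elem_of -[n]add0r; apply: homog_comp; first exact: homog_qcheck.
apply: homogP => i c ci; rewrite -[purel _ _ _]/(c ⊗ₜ u 1).
exact: ofdeg_pure ci (hunit_deg H).
Qed.

(* The Koszul sign makes this a module morphism from the regular module. *)
Definition rmul M (p : int) (v : M) : {linear H -> M} := act M ∘ purel H v ∘ sgn H p.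

Lemma rmul_deg M p i x (v : M) : ofdeg i x ->
  rmul p v x = (-1) ^ (p * i) *: act M (x ⊗ₜ v).
Proof.
move=> xi; rewrite -[rmul p v x]/(act M (purel H v (sgn H p x))).
by rewrite (sgn_deg _ xi) linZ linZ.
Qed.

Lemma rmul_homog M p (v : M) : ofdeg p v -> homog p (rmul p v).
Proof.
move=> vp; apply: homogP => i x xi; rewrite (rmul_deg _ _ xi); apply: ofdegZ.
by have := homog_ofdeg (@act_homog M) (ofdeg_pure xi vp); rewrite addr0.
Qed.

Lemma rmul_mod M p (v : M) : ofdeg p v -> @is_mod_mor k H reg_mod M (rmul p v).
Proof.
move=> vp; apply: (spans_pure (@spans_hom k H) (@spans_hom k H)).
move=> _ [x [y [[i xi] [j yj] ->]]]; rewrite lcompE [RHS]lcompE.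
rewrite (tensM_deg _ _ (rmul_homog vp) xi) (rmul_deg _ _ (hmul_deg xi yj)) (rmul_deg _ _ yj).
by rewrite act_assoc pureZr 2!(linZ (act M)) scalerA -sgnN1 mulrDr.
Qed.

(** No sign appears, even for f of mixed degree, because the counit vanishes outside degree 0. *)
Lemma counit_nat (V W : complexType k) (f : {linear V -> W}) (t : C ⊗ V) :
  (iota W ∘ tensM (counit C) idl) (tensM idl f t) = f ((iota V ∘ tensM (counit C) idl) t).
Proof.
have E : tensM (counit C) idl ∘ tensM idl f = tensM idl f ∘ tensM (counit C) idl.
  rewrite tensM_comp; last exact: homog_id.
  rewrite tensM_comp; last exact: (counit_chain C).1.
  by rewrite !comp_idl !idl_comp.
rewrite -[LHS]/(iota W ((tensM (counit C) idl ∘ tensM idl f) t)) E.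
by rewrite -[LHS]/((iota W ∘ tensM idl f) (tensM (counit C) idl t)) iota_nat.
Qed.

Lemma elem_ofK n eta : is_end n eta -> endo_of (elem_of eta) = eta.
Proof.
move=> eta_n; have [hom comod nat] := eta_n.
apply: functional_extensionality_dep => M.
rewrite -[RHS]colift_qcheck //; congr colift.
apply: tens_ext_hom => i p c v ci vp; rewrite coeff_act_pure.
have ea := homog_ofdeg (elem_of_homog eta_n) ci.
have E := nat reg_mod M p (rmul p v) (rmul_homog vp) (rmul_mod vp) (c ⊗ₜ (u 1 : reg_mod)).
rewrite lscaleE 2!lcompE (tensM_deg _ _ (rmul_homog vp) ci) in E.
have r1 : rmul p v (u 1) = v.
  by rewrite (rmul_deg _ _ (hunit_deg H)) mulr0 scale1r act1.
rewrite r1 (linZ (eta M)) scalerA -sgnN1 in E.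
rewrite -[RHS]/((iota M ∘ tensM (counit C) idl) (eta M (c ⊗ₜ v))).
have := congr1 (iota M ∘ tensM (counit C) idl) E.
rewrite [RHS]linZ counit_nat.
rewrite -[X in rmul p v X = _]/(elem_of eta c) (rmul_deg _ _ ea).
(* Since a(c) has degree i + n, right multiplication by v contributes (-1)^(p (i + n)), which is
   also the sign on the other side; multiplying by it clears both. *)
move=> /(congr1 (fun x => (-1) ^ (p * (i + n)) *: x)).
by rewrite !scalerA sgnsq scale1r mulrDr [p * n]mulrC [p * i + _]addrC sgnsq scale1r.
Qed.

End Fixed.

(** On a coextension, restriction along f composes the projection with f (x) id, which amounts to
    precomposing a with f. Naturality in C reduces to this. *)
Lemma endo_of_comp (C C' : ccdgCoalg k) (f : {linear C -> C'}) (a : {linear C' -> H}) :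
  E_omega_map f (endo_of a) = endo_of (a ∘ f).
Proof.
apply: functional_extensionality_dep => M.
rewrite /E_omega_map qcheck_endo_of tensM_compr -/(colift _); congr colift.
by rewrite /coeff_act -lcompA tensM_comp0 // ?comp_idl //; exact: homog_id.
Qed.

End Reconstruction.

(** * Iterated coproducts and cocommutativity *)

Section Shuffle.
Variables (k : fieldType) (C : ccdgCoalg k).
Local Notation D := (comul C).

Lemma comul_homog : homog 0 D.
Proof. exact: (comul_chain C).1. Qed.

Lemma counit_homog : homog 0 (counit C).
Proof. exact: (counit_chain C).1. Qed.

Lemma counit_counit_comul c : tensM (counit C) (counit C) (D c) = (1 : ground k) ⊗ₜ counit C c.
Proof.
have -> : tensM (counit C) (counit C) = tensM idl (counit C) ∘ tensM (counit C) idl.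
  by rewrite tensM_comp ?comp_idl ?idl_comp //; exact: counit_homog.
by rewrite lcompE counitlE (tensM0 _ _ _ counit_homog).
Qed.

(* By cocommutativity, c1 (x) c2 (x) c3 (x) c4 is unchanged when c2 and c3 are swapped. *)
Lemma mid_comul : mid C C C C ∘ (tensM D D ∘ D) = tensM D D ∘ D.
Proof.
(* [T] exchanges the first two of three tensor factors; by cocommutativity it fixes the iterated
   coproduct [D3]. *)
pose T := assoc C C C ∘ tensM (tau C C) idl ∘ associ C C C.
pose D3 := tensM idl D ∘ D.
have D3E : associ C C C ∘ D3 = tensM D idl ∘ D.
  by rewrite /D3 -comulA_lin lcompA; apply: lin_eq => c; rewrite lcompE [LHS]assocK.
have TD : T ∘ D3 = D3.
  rewrite /T -2!lcompA D3E (lcomp_reassoc (tensM_compl _ _ _)).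
  have -> : tau C C ∘ D = D by apply: lin_eq; exact: comulC.
  exact: comulA_lin.
(* Rebracketing exposes the last three of the four factors, so that the exchange inside [mid]
   becomes [T] applied to [D3]. *)
have D4E : assoc C C (C ⊗ C) ∘ (tensM D D ∘ D) = tensM idl D3 ∘ D.
  have -> : tensM D D = tensM (tensM idl idl) D ∘ tensM D idl.
    by rewrite tensM_comp ?comp_idl ?tensM_id ?idl_comp //; exact: comul_homog.
  rewrite -lcompA (lcomp_reassoc (assoc_nat _ _ _)) -lcompA comulA_lin.
  by rewrite lcompA tensM_compr.
rewrite -[mid C C C C]/(associ C C (C ⊗ C) ∘ tensM idl T ∘ assoc C C (C ⊗ C)).
rewrite -2!lcompA D4E [X in _ ∘ X]lcompA tensM_compr TD -D4E.
by apply: lin_eq => c; rewrite lcompE [LHS]assocK.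
Qed.

End Shuffle.

(** * The groups P_Omega(C) *)

Section Group.
Variables (k : fieldType) (H : ccdgHopf k).
Local Notation u := (hunit H).
Local Notation m := (hmul H).

(** The product of [tens_dga]. Its associativity and unit laws are derived below from those of
    Omega, for convolution with values in Omega (x) Omega. *)
Definition hmul2 : {linear (H ⊗ H) ⊗ (H ⊗ H) -> H ⊗ H} := tensM m m ∘ mid H H H H.

Lemma hmul2_chain : chain_map hmul2.
Proof.
apply: chain_comp; last exact: chain_mid.
by apply: chain_tensM; exact: hmul_chain.
Qed.

Lemma hmul2_pure i j a b c d : ofdeg i b -> ofdeg j c ->
  hmul2 ((a ⊗ₜ b) ⊗ₜ (c ⊗ₜ d)) = (-1) ^ (i * j) *: (m (a ⊗ₜ c) ⊗ₜ m (b ⊗ₜ d)).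
Proof.
move=> bi cj; rewrite /hmul2 lcompE (mid_deg _ _ bi cj) (linZ (tensM _ _)).
by rewrite (tensM0 _ _ _ (@hmul_homog k H)).
Qed.

Lemma hmul2_assoc :
  hmul2 ∘ tensM hmul2 idl = hmul2 ∘ tensM idl hmul2 ∘ assoc (H ⊗ H) (H ⊗ H) (H ⊗ H).
Proof.
have sH := spans_pure (@spans_hom k H) (@spans_hom k H).
apply: lin_eq; apply: (spans_pure (spans_pure sH sH) sH).
move=> _ [_ [_ [[_ [_ [[a [b [[ia ai] [ib bi] ->]]]
  [c [d [[ic ci] [id di] ->]]] ->]]] [e [f [[ie ei] [jf fi] ->]]] ->]]].
rewrite -[LHS]/(hmul2 (tensM hmul2 idl _)) -[RHS]/(hmul2 (tensM idl hmul2 (assoc _ _ _ _))).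
rewrite assoc_pure (tensM0 _ _ _ (@homog_id k _)).
rewrite (tensM0 _ _ _ hmul2_chain.1) (hmul2_pure _ _ bi ci) (hmul2_pure _ _ di ei).
rewrite pureZl pureZr 2!(linZ hmul2).
rewrite (hmul2_pure _ _ (hmul_deg bi di) ei) (hmul2_pure _ _ bi (hmul_deg ci ei)).
by rewrite !scalerA !hmulA -!sgnN1 mulrDl mulrDr addrA addrC.
Qed.

Lemma hmul2_1l t : hmul2 ((u 1 ⊗ₜ u 1) ⊗ₜ t) = t.
Proof.
suff : hmul2 ∘ purer (H ⊗ H) (u 1 ⊗ₜ u 1) =1 idl by exact.
apply: (spans_pure (@spans_hom k H) (@spans_hom k H)) => _ [x [y [[i xi] _ ->]]].
rewrite lcompE -[LHS]/(hmul2 ((u 1 ⊗ₜ u 1) ⊗ₜ (x ⊗ₜ y))).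
by rewrite (hmul2_pure _ _ (hunit_deg H) xi) mul0r scale1r !hmul1l.
Qed.

Lemma hmul2_1r t : hmul2 (t ⊗ₜ (u 1 ⊗ₜ u 1)) = t.
Proof.
suff : hmul2 ∘ purel (H ⊗ H) (u 1 ⊗ₜ u 1) =1 idl by exact.
apply: (spans_pure (@spans_hom k H) (@spans_hom k H)) => _ [x [y [_ [i yi] ->]]].
rewrite lcompE -[LHS]/(hmul2 ((x ⊗ₜ y) ⊗ₜ (u 1 ⊗ₜ u 1))).
by rewrite (hmul2_pure _ _ yi (hunit_deg H)) mulr0 scale1r !hmul1r.
Qed.

Definition hunit2 : {linear ground k -> H ⊗ H} := purel H (u 1) ∘ u.

Lemma hunit2_homog : homog 0 hunit2.
Proof.
apply: homog0_comp (hunit_homog H).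
apply: homogP => i x xi; exact: ofdeg_pure xi (hunit_deg H).
Qed.

Lemma comul_hmul : comul H ∘ m = hmul2 ∘ tensM (comul H) (comul H).
Proof.
apply/lin_eq/tens_ext => x y; rewrite lcompE comul_mul [RHS]lcompE.
by rewrite (tensM0 _ _ _ (@comul_homog k H)).
Qed.

Lemma counit_hmul : counit H ∘ m = iota (ground k) ∘ tensM (counit H) (counit H).
Proof.
apply/lin_eq/tens_ext => x y; rewrite lcompE counit_mul [RHS]lcompE.
by rewrite (tensM0 _ _ _ (@counit_homog k H)) iota_pure.
Qed.

Variable C : ccdgCoalg k.
Implicit Types a b g : {linear C -> H}.
Local Notation D := (comul C).
Local Notation one := (u ∘ counit C).

Lemma comul_conv a b : comul H ∘ conv a b = convA hmul2 (comul H ∘ a) (comul H ∘ b).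
Proof.
rewrite /conv /convA 2!lcompA comul_hmul -[X in X ∘ D]lcompA tensM_comp0 //.
exact: comul_homog.
Qed.

Lemma counit_conv a b :
  counit H ∘ conv a b = iota (ground k) ∘ tensM (counit H ∘ a) (counit H ∘ b) ∘ D.
Proof.
rewrite /conv 2!lcompA counit_hmul -[X in X ∘ D]lcompA tensM_comp0 //.
exact: counit_homog.
Qed.

Lemma hmul2_nat a b a' b' : homog 0 a -> homog 0 b -> homog 0 a' -> homog 0 b' ->
  hmul2 ∘ tensM (tensM a b) (tensM a' b') =
  tensM (m ∘ tensM a a') (m ∘ tensM b b') ∘ mid C C C C.
Proof.
move=> a0 b0 a0' b0'; rewrite /hmul2 -lcompA mid_nat // lcompA.
by rewrite tensM_comp //; exact: homog_tensM0.
Qed.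

(** Both sides evaluate the same product on a fourfold coproduct, with its two middle factors in
    opposite order; [mid_comul] identifies them. *)
Lemma conv_tensM a b a' b' : homog 0 a -> homog 0 b -> homog 0 a' -> homog 0 b' ->
  convA hmul2 (tensM a b ∘ D) (tensM a' b' ∘ D) = tensM (conv a a') (conv b b') ∘ D.
Proof.
move=> a0 b0 a0' b0'; rewrite /convA -tensM_comp0; last exact: homog_tensM0.
rewrite -lcompA -[(tensM _ _ ∘ _) ∘ D]lcompA (lcomp_reassoc (hmul2_nat _ _ _ _)) //.
rewrite -lcompA mid_comul (lcomp_reassoc (tensM_comp _ _ _ (@comul_homog k C))).
by rewrite -!/(conv _ _).
Qed.

Lemma one_coalg_mor : is_coalg_mor one.
Proof.
have uE c : u (counit C c) = (counit C c : k) *: u 1 by rewrite {1}(groundE (counit C c)) linZ.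
split.
- by apply: chain_comp; [exact: hunit_chain | exact: counit_chain].
- by move=> c; rewrite 2!lcompE uE linZ counit_one -groundE.
- move=> c; rewrite 2!lcompE uE linZ comul_one lcompE.
  rewrite -tensM_comp0; last exact: hunit_homog.
  rewrite lcompE counit_counit_comul (tensM0 _ _ _ (hunit_homog H)) uE.
  by rewrite pureZr.
Qed.

Lemma conv_coalg_mor a b : is_coalg_mor a -> is_coalg_mor b -> is_coalg_mor (conv a b).
Proof.
move=> [ac /lin_eq ae /lin_eq aD] [bc /lin_eq be /lin_eq bD].
split.
- apply: chain_comp; last exact: comul_chain.
  by apply: chain_comp; [exact: hmul_chain | exact: chain_tensM].
- move=> c; rewrite counit_conv ae be 2!lcompE counit_counit_comul iota_pure.
  by rewrite scale1r.
- move=> c; rewrite comul_conv aD bD conv_tensM //; [exact: ac.1|exact: ac.1|exact: bc.1|exact: bc.1].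
Qed.

(** By the antipode axiom, [antipode H] is a left inverse of the identity in Hom(Omega, Omega);
    precomposition with g preserves convolution and its unit. *)
Lemma conv_antipodel g : is_coalg_mor g -> conv (antipode H ∘ g) g = one.
Proof.
move=> gm; have := conv_comp (antipode H) idl gm; rewrite idl_comp => <-.
rewrite -(conv_one_comp H gm); congr (_ ∘ _).
by apply: lin_eq; exact: antipodel.
Qed.

Lemma conv_antipoder g : is_coalg_mor g -> conv g (antipode H ∘ g) = one.
Proof.
move=> gm; have := conv_comp idl (antipode H) gm; rewrite idl_comp => <-.
rewrite -(conv_one_comp H gm); congr (_ ∘ _).
by apply: lin_eq; exact: antipoder.
Qed.

(* An inverse of g in Hom(C, Omega) is automatically a coalgebra morphism:
   inverses are unique in Hom(C, Omega (x) Omega). *)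
Lemma antipode_coalg_mor g : is_coalg_mor g -> is_coalg_mor (antipode H ∘ g).
Proof.
move=> gm; have [gc /lin_eq ge /lin_eq gD] := gm.
pose h := antipode H ∘ g; rewrite -/h.
have hg : conv h g = one := conv_antipodel gm.
have gh : conv g h = one := conv_antipoder gm.
have [oc /lin_eq oe /lin_eq oD] := one_coalg_mor.
have h0 : homog 0 h by apply: homog0_comp; [exact: antipode_homog | exact: gc.1].
split.
(* Differentiating h * g = 1, with g and 1 closed, gives dh * g = 0, hence dh = dh * (g * h) = 0. *)
- apply: chain_dHom => //.
  rewrite -[dHom h]conv_unitr -gh conv_assoc.
  suff -> : conv (dHom h) g = lzero C H by exact: conv0l.
  have := dHom_convA h g (hmul_chain H).
  rewrite -!convE hg (dHom_chain oc) (dHom_chain gc) conv0r => ->.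
  by apply: lin_eq => x; rewrite laddE addr0.
(* The counit is applied to h * g = 1; as it is preserved by g, the right counit law leaves the
   counit of h. *)
- move=> c; have E : counit H ∘ conv h g = counit C by rewrite hg oe.
  rewrite counit_conv ge in E; have <- := congr1 (fun f : {linear C -> ground k} => f c) E.
  rewrite -[RHS]/(iota (ground k) (tensM (counit H ∘ h) (idl ∘ counit C) (comul C c))).
  rewrite -tensM_compr [in RHS]lcompE counitrE (tensM0 _ _ _ (@homog_id k (ground k))).
  by rewrite iota_pure -groundE.
- have E2 : comul H ∘ one = hunit2 ∘ counit C.
    apply: lin_eq => c; rewrite -[LHS]/(comul H (u (counit C c))).
    rewrite -[RHS]/(u (counit C c) ⊗ₜ u 1) (groundE (counit C c)) !(linZ u).
    by rewrite (linZ (comul H)) comul_one pureZl.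
  have Ehg : convA hmul2 (tensM h h ∘ D) (tensM g g ∘ D) = hunit2 ∘ counit C.
    by rewrite conv_tensM // ?hg -?E2 ?oD //; exact: gc.1.
  have Egh : convA hmul2 (tensM g g ∘ D) (comul H ∘ h) = hunit2 ∘ counit C.
    by rewrite -gD -comul_conv gh E2.
  suff -> : comul H ∘ h = tensM h h ∘ D by [].
  (* (h (x) h) D is a left inverse and Delta h a right inverse of Delta g = (g (x) g) D, so
     associativity makes them equal. *)
  rewrite -[LHS](@convA_unitl k C _ hmul2 hunit2 _ hmul2_1l).
  rewrite -[RHS](@convA_unitr k C _ hmul2 hunit2 _ hunit2_homog hmul2_1r) -Ehg.
  by rewrite -(convA_assoc _ _ _ hmul2_chain.1 hmul2_assoc) Egh Ehg.
Qed.

Lemma P_Omega_is_grp : is_grp (P_Omega_ob H C).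
Proof.
split=> /=.
- exact: one_coalg_mor.
- exact: conv_coalg_mor.
- by move=> a b c _ _ _; exact: conv_assoc.
- by move=> a _; exact: conv_unitl.
- by move=> a _; exact: conv_unitr.
- move=> g gm; exists (antipode H ∘ g).
  by split; [exact: antipode_coalg_mor | exact: conv_antipoder | exact: conv_antipodel].
Qed.

End Group.

Lemma coalg_mor_comp (k : fieldType) (C C' C'' : ccdgCoalg k) (g : {linear C' -> C''})
    (f : {linear C -> C'}) : is_coalg_mor g -> is_coalg_mor f -> is_coalg_mor (g ∘ f).
Proof.
move=> [gc /lin_eq ge /lin_eq gD] [fc /lin_eq fe /lin_eq fD]; split.
- exact: chain_comp.
- by move=> c; rewrite lcompA ge fe.
- move=> c; rewrite lcompA gD -lcompA fD lcompA tensM_comp //; exact: fc.1.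
Qed.

Lemma P_Omega_presheaf (k : fieldType) (H : ccdgHopf k) : is_presheaf (P_Omega H).
Proof.
split=> /=.
- exact: P_Omega_is_grp.
- move=> C C' f fm; split=> /=; first by move=> g gm; exact: coalg_mor_comp.
  by move=> a b _ _; exact: conv_comp.
- by move=> C a _; exact: comp_idl.
- by move=> C C' C'' g f a _ _ _; exact: lcompA.
Qed.

(** * Tensor compatibility of natural families *)

Section TensorEndomorphisms.
Variables (k : fieldType) (H : ccdgHopf k) (C : ccdgCoalg k).
Local Notation u := (hunit H).
Local Notation D := (comul C).
Implicit Types (a : {linear C -> H}) (M : dgMod H) (V W X : complexType k).

(** Both sides send ((x y) z)(v w) to x ((y v)(z w)) with the sign of exchanging z and v: taking out
    the first factor C commutes with the middle exchange. *)
Lemma mid_assoc V W :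
  assoc C (C ⊗ V) (C ⊗ W) ∘ (tensM (assoc C C V) idl ∘ mid (C ⊗ C) C V W) =
  tensM idl (mid C C V W) ∘ (assoc C (C ⊗ C) (V ⊗ W) ∘ tensM (assoc C C C) idl).
Proof.
have sC := @spans_hom k C.
apply: lin_eq; apply: (spans_pure (spans_pure (spans_pure sC sC) sC)
  (spans_pure (@spans_hom k V) (@spans_hom k W))).
move=> _ [_ [_ [[_ [z [[x [y [_ _ ->]]] [i zi] ->]]] [v [w [[j vj] _ ->]]] ->]]].
rewrite lcompE [X in assoc _ _ _ X]lcompE (mid_deg _ _ zi vj).
rewrite (linZ (tensM _ _)) (linZ (assoc _ _ _)) (tensM0 _ _ _ (@homog_id k _)) assoc_pure.
rewrite assoc_pure [RHS]lcompE [X in tensM _ _ X]lcompE (tensM0 _ _ _ (@homog_id k _)).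
rewrite !assoc_pure (tensM0 _ _ _ (chain_mid _ _ _ _).1) (mid_deg _ _ zi vj).
by rewrite pureZr.
Qed.

(** Coassociativity brings one copy of C outside, so the tensor product of comodule maps is again a
    coextension and can be compared through its projection. *)
Lemma tens_comod_colift V W V' W' (f : {linear C ⊗ V -> W})
    (phi : {linear C ⊗ V' -> C ⊗ W'}) :
  tens_comod (colift f) phi =
  colift (tensM f (qcheck phi) ∘ mid C C V V' ∘ tensM D idl).
Proof.
set f' := qcheck phi; have D0 := @comul_homog k C; have i0 := @homog_id k.
have E1 : assoc C W W' ∘ tensM (colift f) f' =
    tensM idl (tensM f f') ∘ (assoc C (C ⊗ V) (C ⊗ V') ∘ tensM (coact C V) idl).
  rewrite -(comp_idl f') -tensM_comp; last exact: (chain_coact C V).1.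
  by rewrite (lcomp_reassoc (assoc_nat _ _ _)) lcompA comp_idl.
have E2 : tensM (tensM D idl) idl ∘ mid C C V V' = mid (C ⊗ C) C V V' ∘ tensM (tensM D idl) idl.
  by have := mid_nat D0 (i0 C) (i0 V) (i0 V'); rewrite !tensM_id => ->.
have E3 : tensM (assoc C C V) idl ∘ (tensM (tensM D idl) (@idl k (C ⊗ V')) ∘
      (mid C C V V' ∘ tensM D idl)) =
    tensM (assoc C C V) idl ∘ mid (C ⊗ C) C V V' ∘ tensM (tensM D idl ∘ D) idl.
  by rewrite (lcomp_reassoc E2) -[X in _ ∘ X]lcompA tensM_compl lcompA.
have E4 : assoc C (C ⊗ V) (C ⊗ V') ∘ tensM (coact C V) idl ∘ (mid C C V V' ∘ tensM D idl) =
    tensM idl (mid C C V V' ∘ tensM D idl) ∘ coact C (V ⊗ V').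
  rewrite -lcompA [X in tensM X idl]coactE -tensM_compl -[X in _ ∘ X]lcompA E3.
  rewrite lcompA mid_assoc -2!lcompA tensM_compl comulA_lin.
  rewrite -tensM_compl (lcomp_reassoc (assoc_nat _ _ _)) -lcompA -coactE.
  by rewrite lcompA tensM_compr.
rewrite -[LHS]/(assoc C W W' ∘ tensM (colift f) f' ∘ mid C C V V' ∘ tensM D idl).
rewrite -lcompA E1 -lcompA E4 lcompA tensM_compr -lcompA.
by [].
Qed.

(** The action of Omega (x) Omega on M (x) M'; restricted along the coproduct it is the action of
    [tens_mod]. *)
Definition pair_act M M' : {linear (H ⊗ H) ⊗ (M ⊗ M') -> M ⊗ M'} :=
  tensM (act M) (act M') ∘ mid H H M M'.

Lemma endo_of_tens_mod a M M' :
  endo_of a (tens_mod M M') = colift (pair_act M M' ∘ tensM (comul H ∘ a) idl).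
Proof.
congr colift; rewrite -tensM_compl lcompA.
by [].
Qed.

(** With [endo_of_tens_mod], both sides of the tensor condition become [pair_act] after a map C ->
    Omega (x) Omega: Delta a on one side, (a (x) a) D on the other. *)
Lemma tens_comod_endo_of a M M' : homog 0 a ->
  tens_comod (endo_of a M) (endo_of a M') =
  colift (pair_act M M' ∘ tensM (tensM a a ∘ D) idl).
Proof.
move=> a0; have i0 := @homog_id k.
have N : pair_act M M' ∘ tensM (tensM a a) idl =
    tensM (coeff_act a M) (coeff_act a M') ∘ mid C C M M'.
  rewrite /pair_act -lcompA -(tensM_id M M') mid_nat // lcompA tensM_comp //.
  exact: homog_tensM0.
rewrite tens_comod_colift; congr colift.
by rewrite qcheck_endo_of -tensM_compl (lcomp_reassoc N).
Qed.

Lemma tens_end_endo_of a : is_coalg_mor a -> is_tens_end (endo_of a).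
Proof.
move=> [ac /lin_eq ae /lin_eq aD]; split.
- exact: endo_of_is_end ac.1.
- move=> M t; rewrite dHom_chain //.
  apply: chain_comp (chain_coact C M); apply: chain_tensM; first exact: chain_id.
  apply: chain_comp (act_chain M) _; apply: chain_tensM => //; exact: chain_id.
- suff -> : endo_of a (unit_mod H) = idl by [].
  rewrite -(endo_of_one C (unit_mod H)); congr colift.
  apply/lin_eq/tens_ext => c x; rewrite !coeff_act_pure.
  rewrite -[LHS]/(unit_act H (a c ⊗ₜ x)) -[RHS]/(unit_act H (u (counit C c) ⊗ₜ x)).
  rewrite !unit_act_pure; congr (_ *: _); transitivity (counit C c).
    by rewrite -ae.
  exact/esym/(coalg_mor_counit (one_coalg_mor H C)).
- by move=> M M' t; rewrite endo_of_tens_mod tens_comod_endo_of ?aD //; exact: ac.1.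
Qed.

Lemma coalg_mor_elem_of (eta : fam H C) : is_tens_end eta -> is_coalg_mor (elem_of eta).
Proof.
move=> [eta0 etad eta1 etaD]; have a0 := elem_of_homog eta0.
have := elem_ofK eta0; set a := elem_of eta => E; split.
- apply: chain_dHom => //; rewrite -[LHS]endo_ofK; apply: lin_eq => c.
  rewrite -[LHS]/(qcheck (endo_of (dHom a) (reg_mod H)) (c ⊗ₜ (u 1 : reg_mod H))).
  rewrite endo_of_dHom E (lin_eq (etad (reg_mod H))) qcheckE lcompE.
  exact: linear0.
(* Omega acts on the trivial module through its counit, so eta = id there, read at c (x) 1, is the
   counit equation. *)
- move=> c; rewrite lcompE; have := @qcheck_endo_of _ _ _ a (unit_mod H); rewrite E (lin_eq eta1).
  move=> /(congr1 (fun f : {linear C ⊗ unit_mod H -> unit_mod H} => f (c ⊗ₜ (1 : ground k)))).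
  rewrite coeff_act_pure -[RHS]/(unit_act H (a c ⊗ₜ _)) unit_act_pure -groundE => <-.
  rewrite -[LHS]/(iota (ground k) (tensM (counit C) idl (c ⊗ₜ (1 : ground k)))).
  by rewrite (tensM0 _ _ _ (@homog_id k _)) iota_pure -groundE.
- move=> c; pose R := reg_mod H.
  have := lin_eq (etaD R R); rewrite -E endo_of_tens_mod tens_comod_endo_of //.
  move=> /(congr1 (@qcheck k C _ _)); rewrite !coliftK.
  (* As 1 (x) 1 is a right unit for [hmul2], evaluating at it recovers the two maps C -> Omega (x)
     Omega from their actions. *)
  move=> /(congr1 (fun f : {linear C ⊗ (R ⊗ R) -> R ⊗ R} => f (c ⊗ₜ (u 1 ⊗ₜ u 1)))).
  rewrite -[LHS]/(hmul2 H (tensM (comul H ∘ a) idl (c ⊗ₜ (u 1 ⊗ₜ u 1)))).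
  rewrite -[RHS]/(hmul2 H (tensM (tensM a a ∘ D) idl (c ⊗ₜ (u 1 ⊗ₜ u 1)))).
  by rewrite !(tensM0 _ _ _ (@homog_id k _)) !hmul2_1r.
Qed.

End TensorEndomorphisms.

(** * Transport of the presheaf structures along the bijection *)

Section Comparison.
Variables (k : fieldType) (H : ccdgHopf k).
Local Notation u := (hunit H).

Section Fixed.
Variable C : ccdgCoalg k.
Implicit Types (a : {linear C -> H}) (eta theta : fam H C).

Lemma endo_of_lzero : @endo_of k H C (lzero C H) = fun M => lzero _ _.
Proof.
apply: functional_extensionality_dep => M.
by rewrite -(laddNf (lzero C H)) endo_of_lin laddNf.
Qed.

Lemma lin_endo_of s a b :
  (fun M => ladd (lscale s (endo_of a M)) (endo_of b M)) = endo_of (ladd (lscale s a) b).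
Proof. by apply: functional_extensionality_dep => M; rewrite endo_of_lin. Qed.

Lemma ladd_endo_of a b : (fun M => ladd (endo_of a M) (endo_of b M)) = endo_of (ladd a b).
Proof.
apply: functional_extensionality_dep => M.
by rewrite -[in RHS](lscale1f a) endo_of_lin lscale1f.
Qed.

Lemma lscale_endo_of s a : (fun M => lscale s (endo_of a M)) = endo_of (lscale s a).
Proof.
apply: functional_extensionality_dep => M.
by rewrite -[in RHS](laddf0 (lscale s a)) endo_of_lin endo_of_lzero laddf0.
Qed.

Lemma idl_endo_of : (fun M : dgMod H => @idl k (C ⊗ M)) = endo_of (u ∘ counit C).
Proof. by apply: functional_extensionality_dep => M; rewrite endo_of_one. Qed.

Lemma comp_endo_of a b : (fun M => endo_of a M ∘ endo_of b M) = endo_of (conv a b).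
Proof. by apply: functional_extensionality_dep => M; rewrite endo_of_conv. Qed.

Lemma dHom_endo_of a : (fun M => dHom (endo_of a M)) = endo_of (dHom a).
Proof. by apply: functional_extensionality_dep => M; rewrite endo_of_dHom. Qed.

Lemma is_end_ex n eta : is_end n eta -> exists2 a, homog n a & eta = endo_of a.
Proof.
by move=> e; exists (elem_of eta); [exact: elem_of_homog | rewrite (elem_ofK e)].
Qed.

(** Sums of families of different degrees are reached because the correspondence is additive; claims
    about [total] elements can thus be checked on families [endo_of a]. *)
Lemma total_endo_of eta : @total k (E_omega_ob H C) eta -> exists a, eta = endo_of a.
Proof.
elim=> [|n x y /is_end_ex[a _ ->] _ [b ->]]; first by exists (lzero C H); rewrite endo_of_lzero.
by exists (ladd a b); exact: ladd_endo_of.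
Qed.

Lemma E_omega_is_dga : is_dga (E_omega_ob H C).
Proof.
split=> /=.
- by move=> f g h; apply: functional_extensionality_dep => M; apply: lin_eq => x;
    rewrite !laddE addrA.
- by move=> f g; apply: functional_extensionality_dep => M; apply: lin_eq => x;
    rewrite !laddE addrC.
- by move=> f; apply: functional_extensionality_dep => M; exact: ladd0f.
- by move=> f; apply: functional_extensionality_dep => M; exact: laddNf.
- by move=> a b f; apply: functional_extensionality_dep => M; apply: lin_eq => x;
    rewrite !lscaleE scalerA.
- by move=> f; apply: functional_extensionality_dep => M; apply: lin_eq => x;
    rewrite !lscaleE scale1r.
- by move=> a f g; apply: functional_extensionality_dep => M; apply: lin_eq => x;
    rewrite !(laddE, lscaleE) scalerDr.
- by move=> a b f; apply: functional_extensionality_dep => M; apply: lin_eq => x;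
    rewrite !(laddE, lscaleE) scalerDl.
- by move=> n; rewrite -endo_of_lzero; apply: endo_of_is_end; exact: homog_lzero.
- move=> n _ _ /is_end_ex[a an ->] /is_end_ex[b bn ->].
  by rewrite ladd_endo_of; apply: endo_of_is_end; exact: homog_ladd.
- move=> n s _ /is_end_ex[a an ->].
  by rewrite lscale_endo_of; apply: endo_of_is_end; exact: homog_lscale.
(* Injectivity of [endo_of] carries the vanishing sum to Hom(C, Omega), where [lsum_direct]
   applies. *)
- move=> s x us xe; pose a i := elem_of (x i).
  have xa i : x i = endo_of (a i) by rewrite (elem_ofK (xe i)).
  have -> : \big[(fun (f g : fam H C) M => ladd (f M) (g M))/(fun M => lzero _ _)]_(i <- s) x i =
      endo_of (\big[@ladd k C H/lzero C H]_(i <- s) a i).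
    elim: (s) => [|i r IH]; first by rewrite !big_nil endo_of_lzero.
    by rewrite !big_cons IH xa ladd_endo_of.
  rewrite -endo_of_lzero => /(can_inj (@endo_ofK k H C)) a0 i si.
  rewrite xa (lsum_direct us _ a0 si) // => j; exact: elem_of_homog.
- rewrite idl_endo_of; apply: endo_of_is_end; exact: (dga_deg_one (E_Omega_is_dga H C)).
- move=> p q _ _ /is_end_ex[a an ->] /is_end_ex[b bn ->].
  rewrite comp_endo_of; apply: endo_of_is_end; exact: (dga_deg_mul (E_Omega_is_dga H C)).
- by move=> s x y z _ _ _; apply: functional_extensionality_dep => M; rewrite lcomp_linl.
- by move=> s x y z _ _ _; apply: functional_extensionality_dep => M; rewrite lcomp_linr.
- by move=> x y z _ _ _; apply: functional_extensionality_dep => M; rewrite lcompA.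
- by move=> x _; apply: functional_extensionality_dep => M; rewrite idl_comp.
- by move=> x _; apply: functional_extensionality_dep => M; rewrite comp_idl.
- move=> n _ /is_end_ex[a an ->].
  by rewrite dHom_endo_of; apply: endo_of_is_end; exact: homog_dHom.
- by move=> s x y _ _; apply: functional_extensionality_dep => M; rewrite dHom_lin.
- by move=> x _; apply: functional_extensionality_dep => M; rewrite dHom_dHom.
- move=> n x y [xn _ _] _; apply: functional_extensionality_dep => M; rewrite dHom_comp.
  congr (ladd _ _); apply: lin_eq => t.
  by rewrite lscaleE lcompE (conjs_homog _ _ (xn M)) mul1r.
Qed.

Lemma tens_end_ex eta : is_tens_end eta -> exists2 a, is_coalg_mor a & eta = endo_of a.
Proof.
move=> e; have [e0 _ _ _] := e; exists (elem_of eta); last by rewrite (elem_ofK e0).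
exact: coalg_mor_elem_of.
Qed.

Lemma P_omega_is_grp : is_grp (P_omega_ob H C).
Proof.
split=> /=.
- by rewrite idl_endo_of; apply/tens_end_endo_of/one_coalg_mor.
- move=> _ _ /tens_end_ex[a am ->] /tens_end_ex[b bm ->].
  by rewrite comp_endo_of; apply/tens_end_endo_of/conv_coalg_mor.
- by move=> x y z _ _ _; apply: functional_extensionality_dep => M; rewrite lcompA.
- by move=> x _; apply: functional_extensionality_dep => M; rewrite idl_comp.
- by move=> x _; apply: functional_extensionality_dep => M; rewrite comp_idl.
- move=> _ /tens_end_ex[a am ->]; exists (endo_of (antipode H ∘ a)).
  split; first by apply/tens_end_endo_of/antipode_coalg_mor.
  + by rewrite comp_endo_of idl_endo_of conv_antipoder.
  + by rewrite comp_endo_of idl_endo_of conv_antipodel.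
Qed.

End Fixed.

(** On [endo_of a], restriction along f is precomposition of a with f, so functoriality is that of
    E_Omega. *)
Lemma E_omega_presheaf : is_presheaf (E_omega H).
Proof.
split=> /=.
- exact: E_omega_is_dga.
- move=> C C' f fm; have Fm := presheaf_mor (E_Omega_presheaf H) fm; split=> /=.
  + move=> n _ /is_end_ex[a an ->]; rewrite endo_of_comp; apply: endo_of_is_end.
    exact: (dga_mor_deg Fm).
  + move=> s _ _ /total_endo_of[a ->] /total_endo_of[b ->].
    rewrite lin_endo_of !endo_of_comp lcomp_linl.
    by rewrite lin_endo_of.
  + by rewrite !idl_endo_of endo_of_comp conv_one_comp.
  + move=> _ _ /total_endo_of[a ->] /total_endo_of[b ->].
    by rewrite comp_endo_of !endo_of_comp comp_endo_of conv_comp.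
  + move=> _ /total_endo_of[a ->].
    by rewrite dHom_endo_of !endo_of_comp dHom_endo_of dHom_compr //; exact: coalg_mor_chain.
- by move=> C _ /total_endo_of[a ->]; rewrite endo_of_comp comp_idl.
- by move=> C C' C'' g f _ _ _ /total_endo_of[a ->]; rewrite !endo_of_comp lcompA.
Qed.

Lemma P_omega_presheaf : is_presheaf (P_omega H).
Proof.
split=> /=.
- exact: P_omega_is_grp.
- move=> C C' f fm; split=> /=.
    move=> _ /tens_end_ex[a am ->]; rewrite endo_of_comp; apply: tens_end_endo_of.
    exact: coalg_mor_comp.
  move=> _ _ /tens_end_ex[a _ ->] /tens_end_ex[b _ ->].
  by rewrite comp_endo_of !endo_of_comp comp_endo_of conv_comp.
- by move=> C _ /tens_end_ex[a _ ->]; rewrite endo_of_comp comp_idl.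
- by move=> C C' C'' g f _ _ _ /tens_end_ex[a _ ->]; rewrite !endo_of_comp lcompA.
Qed.

End Comparison.

Theorem proposition5p2 (k : fieldType) (k_char0 : [pchar k] =i pred0)
    (Omega : ccdgHopf k) :
  [/\ is_presheaf (E_omega Omega), is_presheaf (E_Omega Omega) &
      nat_iso (E_omega Omega) (E_Omega Omega)] /\
  [/\ is_presheaf (P_omega Omega), is_presheaf (P_Omega Omega) &
      nat_iso (P_omega Omega) (P_Omega Omega)] /\
  nat_iso (forget_grp (P_omega Omega)) (yoneda Omega).
Proof.
have grp_iso : nat_iso (P_omega Omega) (P_Omega Omega).
  exists (fun C => @elem_of k Omega C), (fun C => @endo_of k Omega C); split=> /=.
  - split=> /= [C|C C' f _ _ /tens_end_ex[a _ ->]]; last by rewrite endo_of_comp !endo_ofK.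
    split=> /= [x|_ _ /tens_end_ex[a _ ->] /tens_end_ex[b _ ->]].
      exact: coalg_mor_elem_of.
    by rewrite comp_endo_of !endo_ofK.
  - split=> /= [C|C C' f a _ _]; last by rewrite endo_of_comp.
    by split=> /= [a am|a b _ _]; [exact: tens_end_endo_of | rewrite comp_endo_of].
  - by move=> C _ /tens_end_ex[a _ ->]; rewrite endo_ofK.
  - by move=> C a _; rewrite endo_ofK.
split; last split; [|by split; [exact: P_omega_presheaf|exact: P_Omega_presheaf|]|].
  split; [exact: E_omega_presheaf | exact: E_Omega_presheaf|].
  exists (fun C => @elem_of k Omega C), (fun C => @endo_of k Omega C); split=> /=.
  - split=> /= [C|C C' f _ _ /total_endo_of[a ->]]; last by rewrite endo_of_comp !endo_ofK.
    split=> /= [n _ /is_end_ex[a an ->]|s _ _ /total_endo_of[a ->] /total_endo_of[b ->]|||].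
    + by rewrite endo_ofK.
    + by rewrite lin_endo_of !endo_ofK.
    + by rewrite idl_endo_of endo_ofK.
    + by move=> _ _ /total_endo_of[a ->] /total_endo_of[b ->]; rewrite comp_endo_of !endo_ofK.
    + by move=> _ /total_endo_of[a ->]; rewrite dHom_endo_of !endo_ofK.
  - split=> /= [C|C C' f a _ _]; last by rewrite endo_of_comp.
    split=> /= [n a|s a b _ _||a b _ _|a _].
    + exact: endo_of_is_end.
    + by rewrite lin_endo_of.
    + by rewrite idl_endo_of.
    + by rewrite comp_endo_of.
    + by rewrite dHom_endo_of.
  - by move=> C _ /total_endo_of[a ->]; rewrite endo_ofK.
  - by move=> C a _; rewrite endo_ofK.
(* The underlying sets and restriction maps of P_Omega are by definition those of the presheaf
   represented by Omega, so the group isomorphism serves with multiplicativity forgotten. *)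
have [Phi [Psi [[Phim Phin] [Psim Psin] PhiK PsiK]]] := grp_iso.
exists Phi, Psi; split=> //=; split=> //= C; first exact: (Phim C).1.
exact: (Psim C).1.
Qed.
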